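(* Let $\mathbb{F}$ be an algebraically closed field of characteristic $0$. Let $f \in \mathbb{F}[x_1,\ldots,x_n]$ be computed by an algebraic circuit of size $s$, and let $g$ be a polynomial factor of $f$ of degree $d$. Then there exist polynomials $A, B \in \mathbb{F}[x_1,\ldots,x_n]$, each computable by an algebraic circuit of size $\mathrm{poly}(sd)$, such that the quotient $A/B$ is well defined as an element of the formal power series ring $\mathbb{F}[[x_1,\ldots,x_n]]$ and $g \equiv A/B \bmod \langle x_1,\ldots,x_n\rangle^{d+1}$.
   Context: An algebraic circuit over $\mathbb{F}$ is a directed acyclic graph whose leaves are labelled by variables or field constants and whose internal nodes are addition and multiplication gates; its size is the number of nodes and edges; its degree may be arbitrarily large. Note $B$ need not be invertible in $\mathbb{F}[[\overline{x}]]$ and may have large degree; ''$A/B$ well defined'' means there is a power series $h$ with $A = B h$. Congruence modulo the ideal $\langle \overline{x}\rangle^{d+1}$ means agreement of all homogeneous parts of degree at most $d$.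
   Formalization: The polynomial f is assumed to be non-zero; for f = 0 every g is a factor and the claim fails, e.g. g = x_1+…+x_n with a circuit of size 1 for f. *)

(* Defs.v *)
From HB Require Import structures.
From mathcomp Require Import all_boot all_order all_algebra.
From mathcomp Require Import mpoly.

Set Implicit Arguments.
Unset Strict Implicit.
Unset Printing Implicit Defensive.

Import GRing.Theory.
Local Open Scope ring_scope.

Section Circuits.
Variables (F : fieldType) (n : nat).

Inductive node_label :=
  | LVar of 'I_n
  | LConst of F
  | LAdd
  | LMul.

Definition leaf_label (l : node_label) : bool :=
  match l with LVar _ | LConst _ => true | LAdd | LMul => false end.

(* Gates have unbounded fan-in. [inputs v] lists the tails of the edges       *)
(* entering v; parallel edges are allowed (a product gate may square its      *)
(* input) and are counted with multiplicity.                                  *)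
Record circuit := Circuit {
  node : finType;
  label : node -> node_label;
  inputs : node -> seq node;
  output : node;
  leavesP : forall v, leaf_label (label v) = nilp (inputs v);
  acyclicP : forall u v, u \in inputs v -> ~~ connect (grel inputs) u v
}.

Definition circuit_size (C : circuit) : nat :=
  (#|node C| + \sum_(v : node C) size (inputs v))%N.

Definition gate_value (C : circuit) (val : node C -> {mpoly F[n]})
    (v : node C) : {mpoly F[n]} :=
  match label v with
  | LVar i => 'X_i
  | LConst c => c%:MP
  | LAdd => \sum_(u <- inputs v) val u
  | LMul => \prod_(u <- inputs v) val u
  end.

(* By acyclicity exactly one [val] satisfies the gate equations; see          *)
(* [valuation_exists] and [valuation_unique].                                 *)
Definition valuation (C : circuit) (val : node C -> {mpoly F[n]}) : Prop :=
  forall v, val v = gate_value val v.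

Definition computes (C : circuit) (p : {mpoly F[n]}) : Prop :=
  exists2 val, valuation (C := C) val & val (output C) = p.

Lemma input_rank (C : circuit) (u v : node C) : u \in inputs v ->
  (#|connect (grel (@inputs C)) u| < #|connect (grel (@inputs C)) v|)%N.
Proof.
move=> uv; apply/proper_card/properP; split.
  apply/subsetP=> w; rewrite !inE; apply: connect_trans.
  exact: connect1.
by exists v; rewrite inE ?connect0 // (negPf (acyclicP uv)).
Qed.

Lemma eq_gate_value (C : circuit) (val val' : node C -> {mpoly F[n]}) v :
  {in inputs v, val =1 val'} -> gate_value val v = gate_value val' v.
Proof.
by move=> e; rewrite /gate_value; case: (label v) => //; apply: eq_big_seq.
Qed.

Lemma valuation_unique (C : circuit) (val val' : node C -> {mpoly F[n]}) :
  valuation val -> valuation val' -> val =1 val'.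
Proof.
move=> V V' v; have [k] := ubnP #|connect (grel (@inputs C)) v|.
elim: k v => // k IHk v lt_v; rewrite V V'; apply: eq_gate_value => u uv.
by apply: IHk; apply: leq_trans (input_rank uv) lt_v.
Qed.

Lemma valuation_exists (C : circuit) :
  exists val : node C -> {mpoly F[n]}, valuation val.
Proof.
pose ev := fix ev k (v : node C) : {mpoly F[n]} :=
  if k is k'.+1 then gate_value (ev k') v else 0.
pose r (v : node C) := #|connect (grel (@inputs C)) v|.
have ev_stable k k' v : (r v <= k)%N -> (r v <= k')%N -> ev k v = ev k' v.
  have r_gt0 : (0 < r v)%N by apply/card_gt0P; exists v; rewrite inE connect0.
  elim: k k' v r_gt0 => [|k IHk] [|k'] v r_gt0;
    rewrite ?(leqNgt (r v) 0) ?r_gt0 // => lk lk' /=.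
  apply: eq_gate_value => u /input_rank lt_uv.
  apply: IHk; last 2 first.
  - by rewrite -ltnS; apply: leq_trans lt_uv lk.
  - by rewrite -ltnS; apply: leq_trans lt_uv lk'.
  by apply/card_gt0P; exists u; rewrite inE connect0.
exists (fun v => ev (r v) v) => v.
rewrite (ev_stable (r v) (r v).+1 v) //=.
apply: eq_gate_value => u /input_rank lt_uv.
by apply: ev_stable => //; apply: ltnW.
Qed.

End Circuits.

Section PowerSeries.
Variables (R : comNzRingType) (n : nat).

(* An element of R[[x_1, ..., x_n]], given by its coefficients.               *)
Definition mseries := 'X_{1..n} -> R.

Definition mseries_of_mpoly (p : {mpoly R[n]}) : mseries := fun m => p@_m.

(* Both factors of a decomposition of m have degree at most mdeg m, so the    *)
(* bound on the index type only makes the Cauchy product a finite sum.        *)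
Definition mseries_mul (a b : mseries) : mseries := fun m =>
  \sum_(k : 'X_{1..n < (mdeg m).+1, (mdeg m).+1} | m == (k.1 + k.2)%MM)
     a k.1 * b k.2.

Lemma mseries_of_mpolyM (p q : {mpoly R[n]}) :
  mseries_of_mpoly (p * q) =1
  mseries_mul (mseries_of_mpoly p) (mseries_of_mpoly q).
Proof. by move=> m; apply: mcoeff_poly_mul. Qed.

(* h = A / B in R[[x]]. Nonzeroness of B makes h unique over a domain; B need *)
(* not be a unit.                                                             *)
Definition mseries_quotient (A B : {mpoly R[n]}) (h : mseries) : Prop :=
  B != 0 /\
  mseries_of_mpoly A =1 mseries_mul (mseries_of_mpoly B) h.

(* a = b modulo <x_1, ..., x_n>^(d+1).                                        *)
Definition mseries_eqmod (d : nat) (a b : mseries) : Prop :=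
  forall m : 'X_{1..n}, (mdeg m <= d)%N -> a m = b m.

End PowerSeries.

(* Main.v *)
Require Import Defs.
From HB Require Import structures.
From Stdlib Require Import Classical_Prop.
From mathcomp Require Import all_boot all_order all_algebra.
From mathcomp Require Import mpoly separable generic_quotient.
From mathcomp Require Import zify ring.

Set Implicit Arguments.
Unset Strict Implicit.
Unset Printing Implicit Defensive.

Import GRing.Theory.
Local Open Scope ring_scope.

(* Restrict f and g to the lines x + alpha y, with alpha chosen so that g has *)
(* degree d and a constant leading coefficient in y. Over K = F(x), an        *)
(* irreducible monic factor p of g satisfies f = p^e q with p coprime to q p'.*)
(* At a point b outside the zero set of finitely many denominators this       *)
(* survives reduction: each root rho of p(b, y) is simple, and the Newton     *)
(* iteration for a root of multiplicity e, y := y - e f(y) / f'(y), lifts it. *)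
(* Indeed f / f' = p q / (e p' q + p q') lies in the local ring at b although *)
(* f and f' both vanish to exponential order, and p(y) gets squared. Hence    *)
(* only values of f and f' are needed, e may be exponentially large, and      *)
(* divisions are postponed to the very end. The product of the lifted roots   *)
(* gives g(x + b) up to order d. The point b = 0 is not generic, so g is      *)
(* recovered by interpolating g(x + t beta) from d + 1 values of t to t = 0.  *)

(** For a monic polynomial in [y], the value at [y = 0] is up to sign the product of its roots. On
    the line through [x + b] in direction [alpha], this value is, up to a constant factor, the
    shifted [g (x + b)]. So it suffices to approximate to order [d] the roots of [g] on that line,
    [d] of them with multiplicity. They are also roots of [f], so a Newton step only evaluates [f]
    and its derivative along the line, at a cost linear in [s] whatever the degree of [f]
    ([newton_step], [newton_root], [factor_approx]).

    The iteration works where the Bezout identity [u p + v q p' = 1] has regular coefficients.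
    [line_factors] finds such identities over the field of fractions with one denominator [D], and
    [shifted_factor_approx] moves them to any [b] with [D(b) != 0]. [factor_approximation] returns
    to the origin: [g (x + t beta)] has degree at most [d] in [t], so its value at [t = 0] is a
    combination, with constant weights, of values at [d + 1] good parameters.

    The outcome is a program with divisions whose final value [z] is regular at the origin, although
    intermediate values need not be. Separating numerators from denominators ([slp_num_den]) gives
    [z = A / B] with small circuits. Regularity gives [z = a / b] with [b(0) != 0], where [a] and
    [b] may be large. From [A b = B a], the series of [a / b] is the quotient [A / B], even if [B]
    vanishes at the origin ([mseries_quotient_exists]).

    With [d + 1] points, at most [d] roots at each and [d] steps per root, the size is of order
    [s d^3] for positive [d]. *)

(** * Straight-line programs *)

(* A straight-line program is represented by the list of its values, the most *)
(* recent first.                                                              *)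
Inductive slp (S : unitRingType) (division : bool) (leaf : S -> Prop) :
    seq S -> Prop :=
  | slp_nil : slp division leaf [::]
  | slp_leaf p l : leaf p -> slp division leaf l -> slp division leaf (p :: l)
  | slp_add p q l : p \in l -> q \in l ->
      slp division leaf l -> slp division leaf (p + q :: l)
  | slp_mul p q l : p \in l -> q \in l ->
      slp division leaf l -> slp division leaf (p * q :: l)
  | slp_inv p l : division -> p \in l ->
      slp division leaf l -> slp division leaf (p^-1 :: l).

Section SlpTheory.
Variables (S : unitRingType) (division : bool) (leaf : S -> Prop).
Local Notation slp := (slp division leaf).

Lemma slp_cat l1 l2 : slp l1 -> slp l2 -> slp (l1 ++ l2).
Proof.
move=> s1 s2; elim: s1 => //= [p l|p q l|p q l|p l].
- by move=> lp _; apply: slp_leaf.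
- by move=> pl ql _; apply: slp_add; rewrite mem_cat ?pl ?ql.
- by move=> pl ql _; apply: slp_mul; rewrite mem_cat ?pl ?ql.
- by move=> dv pl _; apply: slp_inv; rewrite // mem_cat pl.
Qed.

Definition computable (m : nat) (z : S) : Prop :=
  exists l, [/\ slp l, (size l <= m)%N & z \in l].

Lemma computable_leaf z : leaf z -> computable 1 z.
Proof.
move=> lz; exists [:: z]; split; rewrite ?inE //.
exact: slp_leaf lz (slp_nil _ _).
Qed.

Lemma computable_le m1 m2 z :
  (m1 <= m2)%N -> computable m1 z -> computable m2 z.
Proof. by move=> le12 [l [sl /leq_trans-/(_ _ le12) ? zl]]; exists l. Qed.

Lemma computable_add m1 m2 z1 z2 : computable m1 z1 -> computable m2 z2 ->
  computable (m1 + m2).+1 (z1 + z2).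
Proof.
move=> [l1 [s1 b1 z1l]] [l2 [s2 b2 z2l]]; exists (z1 + z2 :: l1 ++ l2); split.
- by apply: slp_add (slp_cat s1 s2); rewrite mem_cat ?z1l ?z2l ?orbT.
- by rewrite /= size_cat ltnS leq_add.
- by rewrite inE eqxx.
Qed.

Lemma computable_mul m1 m2 z1 z2 : computable m1 z1 -> computable m2 z2 ->
  computable (m1 + m2).+1 (z1 * z2).
Proof.
move=> [l1 [s1 b1 z1l]] [l2 [s2 b2 z2l]]; exists (z1 * z2 :: l1 ++ l2); split.
- by apply: slp_mul (slp_cat s1 s2); rewrite mem_cat ?z1l ?z2l ?orbT.
- by rewrite /= size_cat ltnS leq_add.
- by rewrite inE eqxx.
Qed.

Lemma computable_sum (I : eqType) (r : seq I) (m : I -> nat) (z : I -> S) :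
  leaf 0 -> {in r, forall i, computable (m i) (z i)} ->
  computable (\sum_(i <- r) (m i).+1).+1 (\sum_(i <- r) z i).
Proof.
move=> l0; elim: r => [|i r IHr] cr.
  by rewrite !big_nil; apply: computable_leaf.
rewrite !big_cons addSn -addnS; apply: computable_add.
  by apply: cr; rewrite inE eqxx.
by apply: IHr => j jr; apply: cr; rewrite inE jr orbT.
Qed.

Lemma computable_prod (I : eqType) (r : seq I) (m : I -> nat) (z : I -> S) :
  leaf 1 -> {in r, forall i, computable (m i) (z i)} ->
  computable (\sum_(i <- r) (m i).+1).+1 (\prod_(i <- r) z i).
Proof.
move=> l1; elim: r => [|i r IHr] cr.
  by rewrite !big_nil; apply: computable_leaf.
rewrite !big_cons addSn -addnS; apply: computable_mul.
  by apply: cr; rewrite inE eqxx.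
by apply: IHr => j jr; apply: cr; rewrite inE jr orbT.
Qed.

End SlpTheory.

(** * Translation between circuits and straight-line programs *)

Section SlpCircuit.
Variables (F : fieldType) (n : nat).
Local Notation R := {mpoly F[n]}.

Definition mpoly_leaf (p : R) : Prop :=
  (exists i, p = 'X_i) \/ (exists c, p = c%:MP).

Local Notation pslp := (slp false mpoly_leaf).

Lemma slp_gate_sum (l us : seq R) : pslp l -> {subset us <= l} ->
  exists l', [/\ pslp (l' ++ l), size l' = (size us).+1
                 & \sum_(u <- us) u \in l'].
Proof.
move=> sl; elim: us => [|u us IHus] sub.
  exists [:: 0]; rewrite big_nil inE; split=> //.
  by apply: slp_leaf => //; right; exists 0; rewrite mpolyC0.
have [l' [s' z' m']] : exists l', [/\ pslp (l' ++ l),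
    size l' = (size us).+1 & \sum_(u <- us) u \in l'].
  by apply: IHus => w wus; apply: sub; rewrite inE wus orbT.
exists (u + \sum_(w <- us) w :: l'); rewrite big_cons inE eqxx /= z'; split=> //.
apply: slp_add s'; rewrite mem_cat ?m' //.
by rewrite sub ?orbT // inE eqxx.
Qed.

Lemma slp_gate_prod (l us : seq R) : pslp l -> {subset us <= l} ->
  exists l', [/\ pslp (l' ++ l), size l' = (size us).+1
                 & \prod_(u <- us) u \in l'].
Proof.
move=> sl; elim: us => [|u us IHus] sub.
  exists [:: 1]; rewrite big_nil inE; split=> //.
  by apply: slp_leaf => //; right; exists 1; rewrite mpolyC1.
have [l' [s' z' m']] : exists l', [/\ pslp (l' ++ l),
    size l' = (size us).+1 & \prod_(u <- us) u \in l'].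
  by apply: IHus => w wus; apply: sub; rewrite inE wus orbT.
exists (u * \prod_(w <- us) w :: l'); rewrite big_cons inE eqxx /= z'; split=> //.
apply: slp_mul s'; rewrite mem_cat ?m' //.
by rewrite sub ?orbT // inE eqxx.
Qed.

(** A node with [k] inputs unfolds into at most [k + 1] entries, which add up to nodes plus edges.
    The induction is over sets closed under inputs, so that shared values are computed once;
    removing a node of maximal rank keeps such a set closed. *)
Lemma slp_of_circuit (C : circuit F n) (p : R) : computes C p ->
  computable false mpoly_leaf (circuit_size C) p.
Proof.
case=> val valP <-.
pose rk (v : node C) := #|connect (grel (@inputs _ _ C)) v|.
suff slp_closed (A : {set node C}) :
    (forall u v, v \in A -> u \in inputs v -> u \in A) ->
    exists l, [/\ pslp l, (size l <= \sum_(v in A) (size (inputs v)).+1)%N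
                  & forall v, v \in A -> val v \in l].
  have [u v _ _|l [sl zl ml]] := slp_closed setT; first by rewrite inE.
  exists l; split=> //; last by apply: ml; rewrite inE.
  apply: leq_trans zl _; rewrite /circuit_size -sum1_card -big_split /=.
  by under [leqRHS]eq_bigr do rewrite add1n; rewrite (eq_bigl predT) // => v; rewrite inE.
have [k] := ubnP #|A|; elim: k A => // k IHk A leAk closedA.
have [->|[v0 v0A]] := set_0Vmem A.
  by exists [::]; split=> // [|v]; [apply: slp_nil | rewrite inE].
have [v vA maxv] : exists2 v, v \in A & forall u, u \in A -> (rk u <= rk v)%N.
  by case: (arg_maxnP rk v0A) => v vA maxv; exists v => // u /maxv.
have [] := IHk (A :\ v).
- by move: leAk; rewrite (cardsD1 v A) vA.
- move=> u w; rewrite !inE => /andP[wv wA] uw; rewrite (closedA u w) // andbT.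
  apply: contraTneq (maxv w wA) => <-; rewrite -ltnNge; exact: input_rank.
move=> l [sl zl ml].
have val_in : {subset map val (inputs v) <= l}.
  move=> _ /mapP[u uv ->]; apply: ml; rewrite !inE (closedA u v) // andbT.
  by apply: contraTneq (input_rank uv) => ->; rewrite ltnn.
have [l' [sl' zl' ml']] : exists l', [/\ pslp (l' ++ l),
    (size l' <= (size (inputs v)).+1)%N & val v \in l'].
  rewrite (valP v) /gate_value; case: (label v) => [i|c||].
  - by exists [:: 'X_i]; rewrite inE; split=> //; apply: slp_leaf => //; left; exists i.
  - by exists [:: c%:MP]; rewrite inE; split=> //; apply: slp_leaf => //; right; exists c.
  - have [l' [s' z' m']] := slp_gate_sum sl val_in.
    by exists l'; rewrite z' size_map -(big_map val predT id).
  - have [l' [s' z' m']] := slp_gate_prod sl val_in.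
    by exists l'; rewrite z' size_map -(big_map val predT id).
exists (l' ++ l); split=> // [|u uA].
  rewrite size_cat (big_setD1 v) //=; exact: leq_add.
rewrite mem_cat; have [->|uv] := eqVneq u v; first by rewrite ml'.
by rewrite ml ?orbT // !inE uv.
Qed.

(** A circuit without a chosen output, carrying its valuation and a rank that witnesses acyclicity;
    in this form a new gate can be added without revisiting the old ones. *)
Record gates := Gates {
  gnode : finType;
  glabel : gnode -> node_label F n;
  ginputs : gnode -> seq gnode;
  grank : gnode -> nat;
  gval : gnode -> R;
  gleavesP : forall v, leaf_label (glabel v) = nilp (ginputs v);
  grankP : forall u v, u \in ginputs v -> (grank u < grank v)%N;
  gvalP : forall v, gval v = match glabel v with
    | LVar i => 'X_i | LConst c => c%:MP
    | LAdd => \sum_(u <- ginputs v) gval u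
    | LMul => \prod_(u <- ginputs v) gval u end
}.

Definition gates_size (G : gates) : nat :=
  (#|gnode G| + \sum_(v : gnode G) size (ginputs v))%N.

Lemma gates_acyclic (G : gates) (u v : gnode G) : u \in ginputs v ->
  ~~ connect (grel (@ginputs G)) u v.
Proof.
move=> uv; apply/negP=> /connectP[s].
have: (grank u < grank v)%N by apply: grankP.
elim: s u {uv} => [|w s IHs] u /= ltuv; first by move=> _ e; rewrite e ltnn in ltuv.
by case/andP=> wu ps e; apply: IHs ps e; apply: ltn_trans (grankP wu) ltuv.
Qed.

Definition circuit_of_gates (G : gates) (v : gnode G) : circuit F n :=
  Circuit v (@gleavesP G) (@gates_acyclic G).

Lemma add_gate (G : gates) (lab : node_label F n) (us : seq (gnode G)) p :
  leaf_label lab = nilp us ->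
  p = match lab with
    | LVar i => 'X_i | LConst c => c%:MP
    | LAdd => \sum_(u <- us) gval u
    | LMul => \prod_(u <- us) gval u end ->
  exists G' : gates, [/\ gates_size G' = (gates_size G + (size us).+1)%N,
    exists v : gnode G', gval v = p
  & forall v : gnode G, exists v' : gnode G', gval v' = gval v].
Proof.
move=> leafP pE.
pose lab' (v : option (gnode G)) := if v is Some w then glabel w else lab.
pose inp' (v : option (gnode G)) :=
  if v is Some w then map Some (ginputs w) else map Some us.
pose rk' (v : option (gnode G)) :=
  if v is Some w then grank w else (\max_(w : gnode G) grank w).+1.
pose val' (v : option (gnode G)) := if v is Some w then gval w else p.
have leaves' v : leaf_label (lab' v) = nilp (inp' v).
  by case: v => [w|] /=; rewrite /nilp size_map; [apply: gleavesP | apply: leafP].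
have rank' u v : u \in inp' v -> (rk' u < rk' v)%N.
  case: v => [w|] /= /mapP[x xw ->] /=; first exact: grankP.
  by rewrite ltnS leq_bigmax.
have valP' v : val' v = match lab' v with
    | LVar i => 'X_i | LConst c => c%:MP
    | LAdd => \sum_(u <- inp' v) val' u
    | LMul => \prod_(u <- inp' v) val' u end.
  case: v => [w|] /=; last by rewrite !big_map.
  by rewrite !big_map; apply: gvalP.
exists (Gates leaves' rank' valP'); split; last by move=> v; exists (Some v).
  rewrite /gates_size /= card_option (bigD1 None) //= size_map.
  rewrite (reindex_omap Some id) => [|[]//].
  rewrite (eq_bigl xpredT) => [|w]; last by rewrite /= eqxx.
  rewrite (eq_bigr (fun w => size (ginputs w))) => [|w _]; last by rewrite size_map.
  by rewrite addnA addSnnS [RHS]addnAC.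
by exists None.
Qed.

(** Each entry becomes one node with at most two incoming edges, whence the factor 3. *)
Lemma gates_of_slp (l : seq R) : pslp l ->
  exists2 G : gates, (gates_size G <= 3 * size l)%N &
    forall p, p \in l -> exists v : gnode G, gval v = p.
Proof.
elim=> {l} [|p l leafp _|p q l pl ql _|p q l pl ql _|//].
- unshelve eexists (@Gates void _ _ _ _ _ _ _); try by case.
  by rewrite /gates_size /= card_void big_pred0 //; case.
- move=> [G sG GP].
  have [lab [leaf_lab pE]] : exists lab, leaf_label lab /\
    p = match lab with
    | LVar i => 'X_i | LConst c => c%:MP
    | LAdd => \sum_(u <- [::]) @gval G u
    | LMul => \prod_(u <- [::]) @gval G u end.
    by case: leafp => -[a ->]; [exists (LVar _ a)|exists (LConst _ a)].
  have [G' [sG' [v vp] GG']] := @add_gate G lab [::] p leaf_lab pE.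
  exists G' => [|r]; first by rewrite sG' /=; lia.
  rewrite inE => /orP[/eqP->|/GP[w <-]]; [by exists v | exact: GG'].
- move=> [G sG GP]; have [v1 e1] := GP _ pl; have [v2 e2] := GP _ ql.
  have [//||G' [sG' [v vp] GG']] :=
    @add_gate G (LAdd _ _) [:: v1; v2] (p + q).
    by rewrite !big_cons big_nil e1 e2 addr0.
  exists G' => [|r]; first by rewrite sG' /=; lia.
  rewrite inE => /orP[/eqP->|/GP[w <-]]; [by exists v | exact: GG'].
- move=> [G sG GP]; have [v1 e1] := GP _ pl; have [v2 e2] := GP _ ql.
  have [//||G' [sG' [v vp] GG']] :=
    @add_gate G (LMul _ _) [:: v1; v2] (p * q).
    by rewrite !big_cons big_nil e1 e2 mulr1.
  exists G' => [|r]; first by rewrite sG' /=; lia.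
  rewrite inE => /orP[/eqP->|/GP[w <-]]; [by exists v | exact: GG'].
Qed.

Lemma circuit_of_slp m (p : R) : computable false mpoly_leaf m p ->
  exists2 C : circuit F n, computes C p & (circuit_size C <= 3 * m)%N.
Proof.
case=> l [sl zl pl]; have [G sG GP] := gates_of_slp sl; have [v <-] := GP _ pl.
exists (circuit_of_gates v); last first.
  by apply: leq_trans sG _; rewrite leq_mul2l.
by exists (@gval G) => // w; apply: gvalP.
Qed.

End SlpCircuit.

(** * The local ring at the origin *)

Section LocalRing.
Variables (F : fieldType) (n : nat).
Local Notation R := {mpoly F[n]}.
Variables (K : fieldType) (iota : {rmorphism R -> K}).
Hypothesis iota_inj : injective iota.
Local Notation "x %:F" := (iota x).

Lemma iota_eq0 p : (p%:F == 0) = (p == 0).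
Proof. by rewrite -(rmorph0 iota) (inj_eq iota_inj). Qed.

(** Membership in the [N]-th power of the ideal generated by the variables. *)
Definition order_ge (N : nat) (a : R) : Prop :=
  forall m, (mdeg m < N)%N -> a@_m = 0.

Lemma order_geD N a b : order_ge N a -> order_ge N b -> order_ge N (a + b).
Proof. by move=> oa ob m lt; rewrite mcoeffD oa // ob // addr0. Qed.

Lemma order_geN N a : order_ge N a -> order_ge N (- a).
Proof. by move=> oa m lt; rewrite mcoeffN oa // oppr0. Qed.

Lemma order_geM N M a b :
  order_ge N a -> order_ge M b -> order_ge (N + M) (a * b).
Proof.
move=> oa ob m lt; rewrite mcoeffM big1 // => k /eqP mE.
have := mdegD k.1 k.2; rewrite -mE => dE.
have [ltk|gek] := ltnP (mdeg k.1) N; first by rewrite oa ?mul0r.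
rewrite ob ?mulr0 // -(ltn_add2l N); apply: leq_ltn_trans lt.
exact: leq_trans (leq_add gek (leqnn _)) (eq_leq (esym dE)).
Qed.

Lemma order_geMl N a b : order_ge N b -> order_ge N (a * b).
Proof. exact: (@order_geM 0). Qed.

Lemma order_geX N k a : order_ge N a -> order_ge (k * N) (a ^+ k).
Proof.
by move=> oa; elim: k => // k IHk; rewrite exprS mulSn; apply: order_geM.
Qed.

Lemma order_ge_le N M a : (M <= N)%N -> order_ge N a -> order_ge M a.
Proof. by move=> le oa m lt; apply: oa; apply: leq_trans le. Qed.

Lemma order_ge1 a : (a@_0 = 0) -> order_ge 1 a.
Proof. by move=> a0 m; rewrite ltnS leqn0 mdeg_eq0 => /eqP->. Qed.

Lemma mcoeff0M (a b : R) : (a * b)@_0 = a@_0 * b@_0.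
Proof. exact: rmorphM. Qed.

Lemma mcoeff0_neq0 (a : R) : a@_0 != 0 -> a != 0.
Proof. by apply: contraNneq => ->; rewrite mcoeff0. Qed.

Definition fconst (c : F) : K := (c%:MP)%:F.

Lemma fconst_is_zmod_morphism : zmod_morphism fconst.
Proof. by move=> a b; rewrite /fconst !rmorphB. Qed.

Lemma fconst_is_monoid_morphism : monoid_morphism fconst.
Proof. by split=> [|a b]; rewrite /fconst ?rmorph1 ?rmorphM. Qed.

HB.instance Definition _ :=
  GRing.isZmodMorphism.Build F K fconst fconst_is_zmod_morphism.
HB.instance Definition _ :=
  GRing.isMonoidMorphism.Build F K fconst fconst_is_monoid_morphism.

(* [adic N] is the N-th power of the maximal ideal of F[x]_(x), seen inside   *)
(* the field of rational functions; [adic 0] is the local ring itself.        *)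
Definition adic (N : nat) (z : K) : Prop :=
  exists a b : R, [/\ z = a%:F / b%:F, b@_0 != 0 & order_ge N a].

Lemma adic_frac N a : order_ge N a -> adic N a%:F.
Proof.
move=> oa; exists a, 1; split=> //; first by rewrite rmorph1 divr1.
by rewrite mcoeff1 eqxx oner_neq0.
Qed.

Lemma adic_const c : adic 0 (fconst c).
Proof. exact: adic_frac. Qed.

Lemma adic0 N : adic N 0.
Proof. by rewrite -(rmorph0 iota); apply: adic_frac => m _; rewrite mcoeff0. Qed.

Lemma adic1 : adic 0 1.
Proof. by rewrite -[1](rmorph1 fconst); apply: adic_const. Qed.

Lemma adicD N x y : adic N x -> adic N y -> adic N (x + y).
Proof.
move=> [a [b [-> b0 oa]]] [a' [b' [-> b'0 oa']]].
exists (a * b' + a' * b), (b * b'); split.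
- by rewrite addf_div ?iota_eq0 ?mcoeff0_neq0 // -!rmorphM -rmorphD.
- by rewrite mcoeff0M mulf_neq0.
- by apply: order_geD; rewrite mulrC; apply: order_geMl.
Qed.

Lemma adicM N M x y : adic N x -> adic M y -> adic (N + M) (x * y).
Proof.
move=> [a [b [-> b0 oa]]] [a' [b' [-> b'0 oa']]].
exists (a * a'), (b * b'); split; last exact: order_geM.
  by rewrite mulf_div -!rmorphM.
by rewrite mcoeff0M mulf_neq0.
Qed.

Lemma adicMl N x y : adic 0 x -> adic N y -> adic N (x * y).
Proof. exact: (@adicM 0). Qed.

Lemma adicMr N x y : adic N x -> adic 0 y -> adic N (x * y).
Proof. by move=> ax ay; rewrite mulrC; apply: adicMl. Qed.

Lemma adicN N x : adic N x -> adic N (- x).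
Proof.
move=> [a [b [-> b0 oa]]]; exists (- a), b; split=> //; last exact: order_geN.
by rewrite rmorphN mulNr.
Qed.

Lemma adicB N x y : adic N x -> adic N y -> adic N (x - y).
Proof. by move=> ax ay; apply: adicD ax (adicN ay). Qed.

Lemma adic_le N M x : (M <= N)%N -> adic N x -> adic M x.
Proof.
by move=> le [a [b [-> b0 oa]]]; exists a, b; split=> //; apply: order_ge_le oa.
Qed.

Lemma adicMn N x k : adic N x -> adic N (x *+ k).
Proof.
move=> ax; elim: k => [|k IHk]; first exact: adic0.
by rewrite mulrS; apply: adicD.
Qed.

Lemma adic_sum N (I : Type) (r : seq I) (P : pred I) (z : I -> K) :
  (forall i, P i -> adic N (z i)) -> adic N (\sum_(i <- r | P i) z i).
Proof.
by move=> az; apply: big_ind => //; [apply: adic0 | move=> *; apply: adicD].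
Qed.

Lemma adic_prod (I : Type) (r : seq I) (P : pred I) (z : I -> K) :
  (forall i, P i -> adic 0 (z i)) -> adic 0 (\prod_(i <- r | P i) z i).
Proof.
by move=> az; apply: big_ind => //; [apply: adic1 | move=> *; apply: adicMl].
Qed.

Lemma adic_const_eq0 c : adic 1 (fconst c) -> c = 0.
Proof.
move=> [a [b [cE b0 oa]]].
have: fconst c * b%:F = a%:F.
  by rewrite cE divfK // iota_eq0 mcoeff0_neq0.
rewrite /fconst -rmorphM => /eqP; rewrite (inj_eq iota_inj) => /eqP/(congr1 (mcoeff 0)).
rewrite mcoeff0M mcoeffC eqxx mulr1 oa ?mdeg0 // => /eqP.
by rewrite mulf_eq0 (negPf b0) orbF => /eqP.
Qed.

Lemma adic_residue z : adic 0 z -> exists c, adic 1 (z - fconst c).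
Proof.
move=> [a [b [-> b0 _]]]; exists (a@_0 / b@_0).
exists (a - (a@_0 / b@_0)%:MP * b), b; split=> //.
  by rewrite rmorphB (rmorphM iota) mulrBl mulfK // iota_eq0 mcoeff0_neq0.
by apply: order_ge1; rewrite mcoeffB mcoeffCM divfK // subrr.
Qed.

(** A nonzero residue means that the numerator does not vanish at the origin, so it may serve as a
    denominator in the local ring. *)
Lemma adic_inv z c : c != 0 -> adic 1 (z - fconst c) ->
  z != 0 /\ adic 0 z^-1.
Proof.
move=> c0 [a [b [zE b0 oa]]].
have bF : b%:F != 0 :> K by rewrite iota_eq0 mcoeff0_neq0.
have {}zE : z = (a + c%:MP * b)%:F / b%:F.
  by rewrite -[LHS](subrK (fconst c)) zE rmorphD (rmorphM iota) mulrDl mulfK.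
have d0 : (a + c%:MP * b)@_0 != 0.
  by rewrite mcoeffD oa ?mdeg0 // add0r mcoeffCM mulf_neq0.
have dF : (a + c%:MP * b)%:F != 0 :> K by rewrite iota_eq0 mcoeff0_neq0.
split; first by rewrite zE mulf_neq0 // invr_eq0.
by exists b, (a + c%:MP * b); rewrite zE invf_div.
Qed.

Lemma adic_mod_horner N (p : {poly K}) y :
  (forall i, adic N p`_i) -> adic 0 y -> adic N p.[y].
Proof.
move=> ap ay; rewrite horner_coef; apply: adic_sum => i _.
apply: adicMr => //; elim: (i : nat) => [|k IHk]; first exact: adic1.
by rewrite exprS; apply: adicMl.
Qed.

Lemma adic_deriv N (p : {poly K}) i :
  (forall i, adic N p`_i) -> adic N (p^`())`_i.
Proof. by move=> ap; rewrite coef_deriv; apply: adicMn. Qed.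

(** The remainder is divisible by [z^2]. Induction on the Horner form avoids higher derivatives:
    passing from [p] to [p * 'X + c] multiplies the remainder by [y + z] and adds [p'(y) z^2]. *)
Lemma adic_taylor N (p : {poly K}) y z : (forall i, adic 0 p`_i) ->
  adic 0 y -> adic N z ->
  adic (N + N) (p.[y + z] - p.[y] - p^`().[y] * z).
Proof.
move=> ap ay az.
elim/poly_ind: p ap => [|p c IHp] ap.
  by rewrite deriv0 !horner0 mul0r !subr0; apply: adic0.
have {}ap i : adic 0 p`_i.
  by have := ap i.+1; rewrite coefD coefMX coefC /= addr0.
rewrite derivD derivM derivX derivC !hornerE.
have -> : p.[y + z] * (y + z) + c - (p.[y] * y + c) -
    (p^`().[y] * y + p.[y]) * z =
    (y + z) * (p.[y + z] - p.[y] - p^`().[y] * z) + p^`().[y] * (z * z).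
  by ring.
have az0 : adic 0 z by apply: adic_le az.
apply: adicD; first by apply: adicMl; [exact: adicD | exact: IHp].
by apply: adicMl; [apply: adic_mod_horner => // i; apply: adic_deriv | apply: adicM].
Qed.

(** Write [P], [P'], [Q], [Q'] for the values at [y] of [p], [q] and their derivatives. Then
    [f(y) = P^(e+1) Q] and [f'(y) = P^e D] with [D = (e+1) P' Q + P Q']. Cancelling [P^e] gives
    [z = -(e+1) P Q / D], so [P + P' z = P^2 Q' / D] is quadratic in [P], like the Taylor remainder.
    Modulo [P], the Bezout identity gives [v D = e + 1], which is nonzero in characteristic 0; hence
    [D] is a unit. *)
Lemma newton_step (f p q u v : {poly K}) (e N : nat) (y : K) :
  (forall k, k.+1%:R != 0 :> F) ->
  (forall i, adic 0 p`_i) -> (forall i, adic 0 q`_i) ->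
  (forall i, adic 0 u`_i) -> (forall i, adic 0 v`_i) ->
  f = p ^+ e.+1 * q -> u * p + v * (q * p^`()) = 1 ->
  adic 0 y -> p.[y] != 0 -> adic N.+1 p.[y] ->
  let z := fconst (- e.+1%:R) * (f.[y] * (f^`().[y])^-1) in
  adic 1 z /\ adic N.+2 p.[y + z].
Proof.
move=> char0 ap aq au av fE uv ay py apy z.
set P := p.[y] in py apy.
set P' := p^`().[y]; set Q := q.[y]; set Q' := q^`().[y].
have ev (r : {poly K}) : (forall i, adic 0 r`_i) -> adic 0 r.[y].
  by move=> ar; apply: adic_mod_horner.
have aP' : adic 0 P' by apply: ev => i; apply: adic_deriv.
have aQ' : adic 0 Q' by apply: ev => i; apply: adic_deriv.
have aQ : adic 0 Q by apply: ev.
have [c cE] : exists c : K, c = e.+1%:R by eexists.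
pose D := c * (P' * Q) + P * Q'.
have uvy : u.[y] * P + v.[y] * (Q * P') = 1.
  by have := congr1 (horner^~ y) uv; rewrite /= !hornerE.
have aP1 : adic 1 P by apply: adic_le apy.
have fe : fconst e.+1%:R = c by rewrite rmorph_nat.
have fne : fconst (- e.+1%:R) = - c by rewrite rmorphN /= fe.
have [vD0 aVD] : v.[y] * D != 0 /\ adic 0 (v.[y] * D)^-1.
  apply: (@adic_inv _ e.+1%:R) => //; rewrite fe.
  have -> : v.[y] * D - c = (v.[y] * Q' - c * u.[y]) * P.
    by rewrite -[X in _ - X]mulr1 -uvy /D; ring.
  apply: adicMl => //; apply: adicB; first by apply: adicMl => //; apply: ev.
  by apply: adicMl; [rewrite -fe; apply: adic_const | apply: ev].
have D0 : D != 0 by apply: contraNneq vD0 => ->; rewrite mulr0.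
have v0 : v.[y] != 0 by apply: contraNneq vD0 => ->; rewrite mul0r.
have aD : adic 0 D^-1.
  have -> : D^-1 = v.[y] * (v.[y] * D)^-1 by rewrite invfM mulrA divff ?mul1r.
  by apply: adicMl => //; apply: ev.
have fy : f.[y] = P ^+ e * (P * Q) by rewrite fE hornerM horner_exp exprSr mulrA.
have f'y : f^`().[y] = P ^+ e * D.
  rewrite fE derivM deriv_exp /= hornerD !hornerM hornerMn hornerM !horner_exp.
  rewrite -/P -/P' -/Q -/Q' /D.
  by rewrite exprSr mulrnAl -mulr_natl -cE; ring.
have zE : z = P * (fconst (- e.+1%:R) * Q * D^-1).
  rewrite /z fy f'y -mulf_div divff ?expf_neq0 // mul1r; ring.
have aw : adic 0 (fconst (- e.+1%:R) * Q * D^-1).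
  by apply: adicMl => //; apply: adicMl => //; apply: adic_const.
have az : adic N.+1 z by rewrite zE; apply: adicMr.
split; first exact: adic_le az.
have -> : p.[y + z] = (p.[y + z] - P - P' * z) + (P + P' * z) by ring.
(* Convergence is quadratic, but one order per step is enough for a polynomial bound. *)
have le2 : (N.+2 <= N.+1 + N.+1)%N by lia.
apply: adicD; first by apply: adic_le le2 _; apply: adic_taylor.
have -> : P + P' * z = (Q' * D^-1) * (P * P).
  have -> : Q' * D^-1 * (P * P) = P * D^-1 * (D - c * (P' * Q)) by rewrite /D; ring.
  by rewrite zE fne mulrBr mulfVK //; ring.
apply: adicMl; first exact: adicMl.
by apply: adic_le le2 _; apply: adicM.
Qed.

End LocalRing.

(** * Restriction to lines *)

Lemma lagrange_horner (K : fieldType) k (y : 'I_k -> K) (r : {poly K}) x :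
  injective y -> (size r <= k)%N ->
  r.[x] = \sum_i r.[y i] * \prod_(j | j != i) ((x - y j) / (y i - y j)).
Proof.
move=> inj_y szr.
pose B i := \prod_(j | j != i) ((y i - y j)^-1 *: ('X - (y j)%:P)).
have BE i z : (B i).[z] = \prod_(j | j != i) ((z - y j) / (y i - y j)).
  rewrite horner_prod; apply: eq_bigr => j _.
  by rewrite hornerZ hornerXsubC mulrC.
suff {1}-> : r = \sum_i r.[y i] *: B i.
  by rewrite horner_sum; apply: eq_bigr => i _; rewrite hornerZ BE.
apply/eqP; rewrite -subr_eq0; apply/eqP.
apply: (@roots_geq_poly_eq0 _ _ (codom y)).
- apply/allP=> _ /codomP[i ->]; rewrite rootE hornerD hornerN horner_sum.
  rewrite (bigD1 i) //= hornerZ BE.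
  rewrite [X in _ * X]big1 => [|j ji]; last first.
    by rewrite divff // subr_eq0 (inj_eq inj_y) eq_sym.
  rewrite mulr1 big1 ?addr0 ?subrr // => j ji; rewrite hornerZ BE (bigD1 i) 1?eq_sym //=.
  by rewrite subrr mul0r mul0r mulr0.
- by rewrite /codom map_inj_uniq // enum_uniq.
rewrite size_codom card_ord; apply: leq_trans (size_polyD _ _) _.
rewrite geq_max szr size_polyN; apply: leq_trans (size_sum _ _ _) _.
apply/bigmax_leqP=> i _; apply: leq_trans (size_scale_leq _ _) _.
rewrite /B scaler_prod; apply: leq_trans (size_scale_leq _ _) _.
rewrite -big_filter size_prod_XsubC size_filter -sum1_count sum1_card cardC1 card_ord.
by rewrite prednK // (leq_ltn_trans _ (ltn_ord i)).
Qed.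

Lemma mpoly_rmorph_eq (F : fieldType) n (S : comNzRingType)
    (phi psi : {rmorphism {mpoly F[n]} -> S}) :
  (forall c, phi c%:MP = psi c%:MP) -> (forall i, phi 'X_i = psi 'X_i) ->
  phi =1 psi.
Proof.
move=> eqC eqX p; rewrite [p]mpolyE !rmorph_sum; apply: eq_bigr => m _.
rewrite -mul_mpolyC !rmorphM eqC mpolyXE_id !rmorph_prod; congr (_ * _).
by apply: eq_bigr => i _; rewrite !rmorphXn eqX.
Qed.

Section Line.
Variables (F : fieldType) (n : nat).
Local Notation R := {mpoly F[n]}.
Variables (K : fieldType) (iota : {rmorphism R -> K}).
Local Notation "x %:F" := (iota x).
Local Notation fconst := (fconst iota).
Implicit Types (b alpha : 'I_n -> F) (p : R).

Definition shift b : R -> R := mmap (@mpolyC n F) (fun i => 'X_i + (b i)%:MP).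

HB.instance Definition _ b := GRing.RMorphism.on (shift b).

Lemma shiftC b c : shift b c%:MP = c%:MP. Proof. exact: mmapC. Qed.

Lemma shiftX b i : shift b 'X_i = 'X_i + (b i)%:MP.
Proof. by rewrite /shift mmapX mmap1U. Qed.

Lemma shift0 p : shift (fun=> 0) p = p.
Proof.
apply: (@mpoly_rmorph_eq _ _ _ (shift (fun=> 0)) idfun) => [c|i] /=.
  exact: shiftC.
by rewrite shiftX mpolyC0 addr0.
Qed.

Lemma mcoeff0_shift b p : (shift b p)@_0 = p.@[b].
Proof.
apply: (@mpoly_rmorph_eq _ _ _ (mcoeff 0 \o shift b) (meval b)) => [c|i] /=.
  by rewrite shiftC mcoeffC eqxx mulr1 mevalC.
by rewrite shiftX mcoeffD mcoeffC eqxx mulr1 mcoeffX mevalXU mnm1_eq0 add0r.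
Qed.

Lemma shift_neq0 b p : p != 0 -> shift b p != 0.
Proof.
apply: contraNneq => s0.
have: shift (fun i => - b i) (shift b p) = p.
  apply: (@mpoly_rmorph_eq _ _ _ (shift (fun i => - b i) \o shift b) idfun).
    by move=> c /=; rewrite !shiftC.
  by move=> i /=; rewrite shiftX rmorphD /= shiftC shiftX mpolyCN subrK.
by rewrite s0 rmorph0 => <-.
Qed.

Definition line b alpha : R -> {poly K} :=
  mmap (polyC \o fconst)
    (fun i => (('X_i + (b i)%:MP)%:F)%:P + fconst (alpha i) *: 'X).

HB.instance Definition _ b alpha := GRing.RMorphism.on (line b alpha).

Lemma lineC b alpha c : line b alpha c%:MP = (fconst c)%:P.
Proof. exact: mmapC. Qed.

Lemma lineX b alpha i : line b alpha 'X_i =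
  (('X_i + (b i)%:MP)%:F)%:P + fconst (alpha i) *: 'X.
Proof. by rewrite /line mmapX mmap1U. Qed.

Lemma horner0_line b alpha p : (line b alpha p).[0] = (shift b p)%:F.
Proof.
apply: (@mpoly_rmorph_eq _ _ _ (horner_eval 0 \o line b alpha) (iota \o shift b)).
  by move=> c /=; rewrite /horner_eval lineC hornerC shiftC.
move=> i /=; rewrite /horner_eval lineX shiftX.
by rewrite hornerD hornerC hornerZ hornerX mulr0 addr0.
Qed.

Lemma horner_line_shift beta t p :
  (line (fun=> 0) beta p).[fconst t] = (shift (fun i => t * beta i) p)%:F.
Proof.
apply: (@mpoly_rmorph_eq _ _ _ (horner_eval (fconst t) \o line (fun=> 0) beta)
         (iota \o shift (fun i => t * beta i))) => [c|i] /=.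
  by rewrite /horner_eval lineC hornerC shiftC.
rewrite /horner_eval lineX shiftX hornerD hornerC hornerZ hornerX.
by rewrite mpolyC0 addr0 rmorphD -rmorphM mulrC.
Qed.

Definition topform (d : nat) p : R := \sum_(m <- msupp p | mdeg m == d) p@_m *: 'X_[m].

Lemma line_mnm b alpha m : (size (line b alpha 'X_[m]) <= (mdeg m).+1)%N /\
  (line b alpha 'X_[m])`_(mdeg m) = fconst ('X_[m]).@[alpha].
Proof.
pose P m := (size (line b alpha 'X_[m]) <= (mdeg m).+1)%N /\
  (line b alpha 'X_[m])`_(mdeg m) = fconst ('X_[m]).@[alpha].
have P0 : P 0%MM.
  rewrite /P mdeg0 mpolyX0 !rmorph1 size_poly1; split=> //.
  by rewrite coef1.
have PD m1 m2 : P m1 -> P m2 -> P (m1 + m2)%MM.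
  move=> [s1 c1] [s2 c2]; rewrite /P mpolyXD mevalM (rmorphM (line b alpha)).
  rewrite (rmorphM fconst) /= mdegD -c1 -c2.
  split.
    by apply: leq_trans (size_polyMleq _ _) _; move: s1 s2; lia.
  rewrite coefM (bigD1 (inord (mdeg m1))) //= inordK; last by lia.
  rewrite addKn big1 ?addr0 // => i /eqP ni.
  have [lt|] := ltnP i (mdeg m1).
    by rewrite [X in _ * X]nth_default ?mulr0 //; apply: leq_trans s2 _; lia.
  rewrite leq_eqVlt => /orP[/eqP e|lt].
    by case: ni; apply: val_inj; rewrite /= inordK //; lia.
  by rewrite [X in X * _]nth_default ?mul0r //; apply: leq_trans s1 _.
have PU i : P U_(i)%MM.
  rewrite /P mdeg1 lineX mevalXU; split.
    apply: leq_trans (size_polyD _ _) _; rewrite geq_max.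
    rewrite (leq_trans (size_polyC_leq1 _)) //=.
    by apply: leq_trans (size_scale_leq _ _) _; rewrite size_polyX.
  by rewrite coefD coefC coefZ coefX /= add0r mulr1.
rewrite -/(P m) (multinomUE_id m); apply: big_ind => // i _.
elim: (m i) => [|k IHk]; first by rewrite mulm0n.
by rewrite mulmS; apply: PD.
Qed.

Lemma size_line b alpha p : (size (line b alpha p) <= msize p)%N.
Proof.
rewrite [p in line _ _ p]mpolyE rmorph_sum; apply: leq_trans (size_sum _ _ _) _.
apply/bigmax_leqP_seq => m mp _.
rewrite -mul_mpolyC rmorphM /= lineC mul_polyC.
apply: leq_trans (size_scale_leq _ _) _.
exact: leq_trans (line_mnm _ _ _).1 (msize_mdeg_lt mp).
Qed.

(** Monomials of degree below [d] do not reach [y^d], and one of degree [d] contributes only its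
    value at [alpha]; thus the coefficient does not involve [x]. *)
Lemma line_topcoef b alpha p d : (msize p <= d.+1)%N ->
  (line b alpha p)`_d = fconst (topform d p).@[alpha].
Proof.
move=> szp; rewrite /topform (raddf_sum (meval alpha)) (rmorph_sum fconst) /=.
rewrite [p in LHS]mpolyE (rmorph_sum (line b alpha)) coef_sum [RHS]big_mkcond.
apply: eq_big_seq => m mp.
rewrite -mul_mpolyC rmorphM /= lineC mul_polyC coefZ.
case: eqP => [<-|/eqP nd].
  by rewrite (line_mnm _ _ _).2 mevalM mevalC (rmorphM fconst).
rewrite nth_default ?mulr0 //; apply: leq_trans (line_mnm _ _ _).1 _.
by have := leq_trans (msize_mdeg_lt mp) szp; rewrite ltnS leq_eqVlt (negPf nd).
Qed.

Lemma topform_neq0 p d : msize p = d.+1 -> topform d p != 0.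
Proof.
move=> szp; have p0 : p != 0 by rewrite -msize_poly_eq0 szp.
have degl : mdeg (mlead p) = d by have := mlead_deg p0; rewrite szp => -[].
apply/eqP=> /(congr1 (mcoeff (mlead p))); rewrite mcoeff0 /topform raddf_sum /=.
rewrite -big_filter (bigD1_seq (mlead p)) ?filter_uniq ?msupp_uniq //=; last first.
  by rewrite mem_filter degl eqxx mlead_supp.
rewrite mcoeffZ mcoeffX eqxx mulr1 big1 ?addr0 => [/eqP|m nm].
  by rewrite mleadc_eq0 (negPf p0).
by rewrite mcoeffZ mcoeffX (negPf nm) mulr0.
Qed.

Definition frac_leaf (z : K) : Prop := exists2 p, mpoly_leaf p & z = p%:F.
Local Notation fslp := (slp true frac_leaf).

Lemma frac_leafC c : frac_leaf (fconst c).
Proof. by exists c%:MP => //; right; exists c. Qed.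

Lemma frac_leafX i : frac_leaf (('X_i)%:F).
Proof. by exists 'X_i => //; left; exists i. Qed.

(* Forward-mode differentiation: each gate also computes the derivative along *)
(* the line.                                                                  *)
Lemma slp_line b alpha (l : seq R) (L : seq K) y :
  slp false (@mpoly_leaf F n) l -> fslp L -> y \in L ->
  exists L', [/\ fslp (L' ++ L), (size L' <= 6 * size l)%N &
    forall p, p \in l -> (line b alpha p).[y] \in L' ++ L /\
                         (line b alpha p)^`().[y] \in L' ++ L].
Proof.
move=> sl sL yL; elim: sl => {l} [|p l lp _|p q l pl ql _|p q l pl ql _|//].
- by exists [::].
- move=> [L' [sL' zL' memL']]; case: lp => -[a ->].
    exists [:: ('X_a + (b a)%:MP)%:F + fconst (alpha a) * y,
      fconst (alpha a) * y, fconst (alpha a), ('X_a)%:F + fconst (b a),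
      fconst (b a), ('X_a)%:F & L']; split=> [||r].
    + apply: slp_add; rewrite ?inE ?rmorphD ?eqxx ?orbT //.
      apply: slp_mul; rewrite ?inE ?mem_cat ?eqxx ?yL ?orbT //.
      apply: slp_leaf; first exact: frac_leafC.
      apply: slp_add; rewrite ?inE ?eqxx ?orbT //.
      apply: slp_leaf; first exact: frac_leafC.
      by apply: slp_leaf sL'; exact: frac_leafX.
    + by rewrite /=; lia.
    + rewrite inE => /orP[/eqP->|/memL'[m1 m2]]; last first.
        by split; rewrite !inE ?m1 ?m2 ?orbT.
      rewrite lineX derivD derivC derivZ derivX !hornerE.
      by rewrite !inE !eqxx ?orbT.
  exists [:: fconst a, 0 & L']; split=> [||r].
  + apply: slp_leaf; first exact: frac_leafC.
    by apply: slp_leaf sL'; rewrite -[0](rmorph0 fconst); exact: frac_leafC.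
  + by rewrite /=; lia.
  + rewrite inE => /orP[/eqP->|/memL'[m1 m2]]; last first.
      by split; rewrite !inE ?m1 ?m2 ?orbT.
    by rewrite lineC derivC !hornerE !inE !eqxx ?orbT.
- move=> [L' [sL' zL' memL']].
  have [p1 p2] := memL' _ pl; have [q1 q2] := memL' _ ql.
  exists [:: (line b alpha (p + q)).[y], (line b alpha (p + q))^`().[y] & L'].
  rewrite rmorphD derivD !hornerD; split=> [||r].
  + by do 2![apply: slp_add; rewrite ?inE ?p1 ?p2 ?q1 ?q2 ?orbT //].
  + by rewrite /=; lia.
  + rewrite inE => /orP[/eqP->|/memL'[m1 m2]]; last first.
      by split; rewrite !inE ?m1 ?m2 ?orbT.
    by rewrite rmorphD derivD !hornerD !inE !eqxx ?orbT.
- move=> [L' [sL' zL' memL']].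
  have [p1 p2] := memL' _ pl; have [q1 q2] := memL' _ ql.
  set p_ := line b alpha p in p1 p2 *; set q_ := line b alpha q in q1 q2 *.
  exists [:: p_.[y] * q_.[y], p_^`().[y] * q_.[y] + p_.[y] * q_^`().[y],
    p_^`().[y] * q_.[y], p_.[y] * q_^`().[y] & L']; split=> [||r].
  + apply: slp_mul; rewrite ?inE ?p1 ?q1 ?orbT //.
    apply: slp_add; rewrite ?inE ?eqxx ?orbT //.
    by do 2![apply: slp_mul; rewrite ?inE ?p1 ?p2 ?q1 ?q2 ?orbT //].
  + by rewrite /=; lia.
  + rewrite inE => /orP[/eqP->|/memL'[m1 m2]]; last first.
      by split; rewrite !inE ?m1 ?m2 ?orbT.
    by rewrite rmorphM derivM hornerD !hornerM !inE !eqxx ?orbT.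
Qed.

End Line.

(** * Newton iteration at a multiple root *)

Section Newton.
Variables (F : closedFieldType) (n : nat).
Local Notation R := {mpoly F[n]}.
Variables (K : fieldType) (iota : {rmorphism R -> K}).
Hypothesis iota_inj : injective iota.
Hypothesis char0 : forall k, k.+1%:R != 0 :> F.
Local Notation fconst := (fconst iota).
Local Notation adic := (adic iota).
Local Notation fcomputable := (computable true (frac_leaf iota)).
#[local] Hint Resolve iota_inj : core.

Variables (b alpha : 'I_n -> F) (f : R) (s : nat).
Hypothesis f_slp : computable false (@mpoly_leaf F n) s f.
Variables (p q u v : {poly K}) (e : nat).
Hypotheses (ap : forall i, adic 0 p`_i) (aq : forall i, adic 0 q`_i).
Hypotheses (au : forall i, adic 0 u`_i) (av : forall i, adic 0 v`_i).
Hypothesis fE : line iota b alpha f = p ^+ e.+1 * q.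
Hypothesis uv : u * p + v * (q * p^`()) = 1.

Lemma newton_root (rho : F) (N : nat) : adic 1 p.[fconst rho] ->
  exists y, [/\ adic 1 (y - fconst rho), adic N.+1 p.[y]
              & fcomputable (N * (6 * s + 5)).+1 y].
Proof.
move=> prho; elim: N => [|N [y [yr py cy]]].
  exists (fconst rho); split=> //; first by rewrite subrr; apply: adic0.
  exact: computable_leaf (frac_leafC _ _).
(* [newton_step] cancels a power of [p.[y]]; if that value is zero, [y] is an exact root and is
   kept. *)
have [p0|pn0] := eqVneq p.[y] 0.
  exists y; split=> //; first by rewrite p0; apply: adic0.
  by apply: computable_le cy; rewrite ltnS leq_mul2r leqnSn orbT.
have ay : adic 0 y.
  rewrite -(subrK (fconst rho) y); apply: adicD => //; last exact: adic_const.
  exact: adic_le yr.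
have [az apz] := newton_step iota_inj char0 ap aq au av fE uv ay pn0 py.
set z := (X in adic 1 X) in az apz; exists (y + z); split=> //.
  by rewrite addrAC; apply: adicD.
have [L [sL zL yL]] := cy; have [l [sl zl fl]] := f_slp.
have [L' [sL' zL' memL']] := slp_line b alpha sl sL yL.
have [fy f'y] := memL' _ fl.
set fy_ := (_.[y]) in fy; set f'y_ := (_^`().[y]) in f'y.
(* These five entries and the [6 * s] from [slp_line] are the cost of one step. The multiplicity
   [e.+1] is a single constant leaf, however large it is. *)
exists [:: y + z, z, fconst (- e.+1%:R), fy_ * f'y_^-1, f'y_^-1 & L' ++ L].
split; last by rewrite inE eqxx.
- apply: slp_add; rewrite ?inE ?mem_cat ?eqxx ?yL ?orbT //.
  apply: slp_mul; rewrite ?inE ?eqxx ?orbT //.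
  apply: slp_leaf; first exact: frac_leafC.
  apply: slp_mul; rewrite ?inE ?eqxx ?fy ?orbT //.
  exact: slp_inv.
- rewrite /= size_cat mulSn; move: zL zL' (leq_mul (leqnn 6) zl).
  by move: (size L) (size L') (size l) (N * _)%N => ? ? ? ?; lia.
Qed.

Hypothesis p_monic : p \is monic.

(** Coefficients are reduced modulo the maximal ideal; since [p] is monic, the degree is
    preserved. *)
Lemma residue_poly : exists pbar : {poly F},
  [/\ pbar \is monic, size pbar = size p
    & forall i, adic 1 (p - map_poly fconst pbar)`_i].
Proof.
have szp : (0 < size p)%N by rewrite size_poly_gt0 monic_neq0.
have [c cP] : exists c : 'I_(size p) -> F,
    forall i : 'I_(size p), adic 1 (p`_i - fconst (c i)).
  apply: (@fin_all_exists 'I_(size p) (fun=> F) (fun i c => adic 1 (p`_i - fconst c))) => i.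
  exact: adic_residue.
pose pbar := \poly_(i < size p) (if insub i is Some j then c j else 0).
have pbarE (i : 'I_(size p)) : pbar`_i = c i by rewrite coef_poly ltn_ord valK.
have top : pbar`_(size p).-1 = 1.
  have lt : ((size p).-1 < size p)%N by rewrite prednK.
  have := cP (Ordinal lt); rewrite -pbarE /= -lead_coefE (monicP p_monic).
  rewrite -[1 in X in X -> _](rmorph1 fconst) -rmorphB => /(adic_const_eq0 iota_inj).
  by move/eqP; rewrite subr_eq0 => /eqP<-.
have szpbar : size pbar = size p.
  apply/eqP; rewrite eqn_leq size_poly -(prednK szp) ltnNge.
  by apply/negP=> /leq_sizeP/(_ _ (leqnn _))/eqP; rewrite top oner_eq0.
exists pbar; split=> // [|i]; first by rewrite monicE lead_coefE szpbar top.
rewrite coefB coef_map /=; have [lti|gei] := ltnP i (size p).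
  by rewrite (pbarE (Ordinal lti)); apply: (cP (Ordinal lti)).
by rewrite !nth_default ?szpbar // rmorph0 subr0; apply: adic0.
Qed.

(** A common root of the reduction of [p] and its derivative would put [1 = u p + v q p'] into the
    maximal ideal. So the reduction has simple roots only, and it splits because [F] is
    algebraically closed. *)
Lemma residue_roots : exists rs : seq F,
  [/\ uniq rs, size p = (size rs).+1 & forall rho, rho \in rs -> adic 1 p.[fconst rho]].
Proof.
have [pbar [monb szb resb]] := residue_poly.
have hornerb (r : {poly K}) (rbar : {poly F}) rho :
    (forall i, adic 1 (r - map_poly fconst rbar)`_i) -> root rbar rho ->
    adic 1 r.[fconst rho].
  move=> resr /rootP r0; rewrite -(subrK (map_poly fconst rbar) r) hornerD.
  rewrite horner_map /= r0 rmorph0 addr0; apply: adic_mod_horner => //.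
  exact: adic_const.
have [rs rsE] := closed_field_poly_normal pbar.
rewrite (monicP monb) scale1r in rsE.
exists rs; split.
- rewrite -separable_prod_XsubC -rsE separable_poly.unlock; apply: contraT => ncop.
  have [rho] : exists rho, root (gcdp pbar pbar^`()) rho.
    by apply/closed_rootP.
  rewrite root_gcd => /andP[r1 r2].
  have a1 := hornerb _ _ _ resb r1.
  have a2 : adic 1 p^`().[fconst rho].
    apply: hornerb r2 => i; rewrite -deriv_map -derivB; exact: adic_deriv.
  have ac := adic_const iota rho.
  have : adic 1 1.
    have -> : 1 = (u * p + v * (q * p^`())).[fconst rho] by rewrite uv hornerC.
    rewrite hornerD !hornerM; apply: adicD => //.
      by apply: adicMl => //; apply: adic_mod_horner.
    by do 2![apply: adicMl => //; first by apply: adic_mod_horner].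
  rewrite -[X in adic 1 X](rmorph1 fconst) => /(adic_const_eq0 iota_inj)/eqP.
  by rewrite oner_eq0.
- by rewrite -szb rsE size_prod_XsubC.
- by move=> rho rrs; apply: hornerb resb _; rewrite rsE root_prod_XsubC.
Qed.

(** Let [P] be the product of the ['X - (y i)%:P] over the approximate roots. As [p] and [P] are
    monic of equal degree, [p - P] is determined by its values at the [y i], which are the small
    [p.[y i]]. The differences [y i - y j] are units, their residues being nonzero, so interpolation
    at 0 loses no precision and [P.[0]] approximates [p.[0]]. *)
Lemma factor_approx (N : nat) : exists w,
  adic N.+1 (p.[0] - w) /\
  fcomputable ((size p).-1 * (N * (6 * s + 5) + 4)).+1 w.
Proof.
have [rs [uniq_rs szp rootP]] := residue_roots.
pose k := size rs; pose rho (i : 'I_k) := rs`_i.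
have [y yP] : exists y : 'I_k -> K, forall i, [/\ adic 1 (y i - fconst (rho i)),
    adic N.+1 p.[y i] & fcomputable (N * (6 * s + 5)).+1 (y i)].
  apply: (@fin_all_exists 'I_k (fun=> K) (fun i z => [/\ adic 1 (z - fconst (rho i)),
    adic N.+1 p.[z] & fcomputable (N * (6 * s + 5)).+1 z])) => i.
  by apply: newton_root; apply: rootP; apply: mem_nth.
have ay i : adic 0 (y i).
  rewrite -(subrK (fconst (rho i)) (y i)).
  by apply: adicD => //; [case: (yP i) => /adic_le ay _ _; apply: ay | apply: adic_const].
have ydiff i j : i != j -> (y i - y j != 0) /\ adic 0 (y i - y j)^-1.
  move=> nij; apply: (@adic_inv _ _ _ _ iota_inj _ (rho i - rho j)).
    by rewrite subr_eq0 nth_uniq.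
  have -> : y i - y j - fconst (rho i - rho j) =
      (y i - fconst (rho i)) - (y j - fconst (rho j)) by rewrite rmorphB /=; ring.
  by case: (yP i) => ? _ _; case: (yP j) => ? _ _; apply: adicB.
have inj_y : injective y.
  by move=> i j eij; apply: contraTeq isT => /ydiff[+ _]; rewrite eij subrr eqxx.
pose P := \prod_i ('X - (y i)%:P).
have szP : size P = k.+1.
  by rewrite size_prod_XsubC /index_enum -enumT size_enum_ord.
have monP : P \is monic by apply: monic_prod_XsubC.
have szB : (size (p - P)%R <= k)%N.
  have coefk (r : {poly K}) : r \is monic -> size r = k.+1 -> r`_k = 1.
    by move=> /monicP lr szr; rewrite -lr lead_coefE szr.
  apply/leq_sizeP => j; rewrite leq_eqVlt => /orP[/eqP<-|ltkj].
    by rewrite coefB !coefk // subrr.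
  by rewrite coefB !nth_default ?szP ?szp // subrr.
exists P.[0]; split.
  rewrite -hornerN -hornerD (lagrange_horner _ inj_y szB).
  apply: adic_sum => // i _; apply: adicMr => //; last first.
    apply: adic_prod => // j ji; rewrite sub0r; apply: adicMl => //.
      exact: adicN.
    by rewrite eq_sym in ji; case: (ydiff _ _ ji).
  rewrite hornerD hornerN horner_prod (bigD1 i) //= hornerXsubC subrr mul0r subr0.
  by case: (yP i).
rewrite horner_prod szp /=.
rewrite (eq_bigr (fun i => fconst (-1) * y i)) => [|i _]; last first.
  by rewrite hornerXsubC rmorphN1 mulN1r sub0r.
have -> : (k * (N * (6 * s + 5) + 4))%N =
    (\sum_(i : 'I_k) (1 + (N * (6 * s + 5)).+1).+2)%N.
  by rewrite sum_nat_const card_ord; congr (_ * _)%N; lia.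
apply: computable_prod => [|i _].
  by rewrite -(rmorph1 fconst); apply: frac_leafC.
apply: computable_mul; last by case: (yP i).
exact: computable_leaf (frac_leafC _ _).
Qed.

End Newton.

(** * Factorization over a field *)

Section PolyFactor.
Variable K : fieldType.
Implicit Types p q f g : {poly K}.

(** A nonconstant divisor of least degree is irreducible; excluded middle decides whether a smaller
    one exists. *)
Lemma irreducible_monic_divisor p : (1 < size p)%N ->
  exists r, [/\ irreducible_poly r, r \is monic & r %| p].
Proof.
have [k] := ubnP (size p); elim: k p => // k IHk p ltpk p1.
have [[q [q1 ltqp qp]]|min_p] :=
  classic (exists q, [/\ (1 < size q)%N, (size q < size p)%N & q %| p]).
  have [|//|r [ir mr rq]] := IHk q; first exact: leq_trans ltqp ltpk.
  by exists r; split=> //; apply: dvdp_trans qp.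
have p0 : p != 0 by rewrite -size_poly_gt0 ltnW.
have lp : (lead_coef p)^-1 != 0 by rewrite invr_eq0 lead_coef_eq0.
exists ((lead_coef p)^-1 *: p); split; last by rewrite dvdpZl.
  split=> [|q q1]; first by rewrite size_scale.
  rewrite dvdpZr // eqp_sym => qp; rewrite (eqp_ltrans (eqp_scale _ lp)) eqp_sym.
  rewrite -(dvdp_size_eqp qp) eqn_leq dvdp_leq //= leqNgt; apply/negP=> lt.
  apply: min_p; exists q; split=> //; rewrite ltn_neqAle eq_sym q1 size_poly_gt0.
  exact: dvdpN0 qp p0.
by rewrite monicE lead_coefZ mulVf // lead_coef_eq0.
Qed.

Lemma irreducible_factorization g : g != 0 ->
  exists2 ps : seq {poly K}, forall p, p \in ps -> irreducible_poly p /\ p \is monic &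
    g = lead_coef g *: \prod_(p <- ps) p.
Proof.
have [k] := ubnP (size g); elim: k g => // k IHk g ltgk g0.
have [sz1|gt1] := leqP (size g) 1.
  exists [::] => //; rewrite big_nil {1}(size1_polyC sz1) alg_polyC.
  by rewrite {2}(size1_polyC sz1) lead_coefC.
have [r [ir mr /dvdpP[h gE]]] := irreducible_monic_divisor gt1.
have h0 : h != 0 by apply: contraNneq g0 => h0; rewrite gE h0 mul0r.
have [|ps psP hE] := IHk h _ h0.
  by move: ltgk ir.1; rewrite gE size_Mmonic //; move: (size h) (size r); lia.
exists (r :: ps) => [p|]; first by rewrite inE => /orP[/eqP->|/psP].
by rewrite big_cons {2}gE lead_coef_Mmonic // scalerAr -hE mulrC.
Qed.

Lemma irreducible_multiplicity p f : irreducible_poly p -> p \is monic ->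
  f != 0 -> p %| f ->
  exists e q, f = p ^+ e.+1 * q /\ ~~ (p %| q).
Proof.
move=> ir mp; have [k] := ubnP (size f); elim: k f => // k IHk f ltfk f0.
case/dvdpP=> h fE.
have h0 : h != 0 by apply: contraNneq f0 => h0; rewrite fE h0 mul0r.
have [ph|nph] := boolP (p %| h); last by exists 0, h; rewrite expr1 mulrC.
have [||//|e [q [hE npq]]] := IHk h => //.
  by move: ltfk ir.1; rewrite fE size_Mmonic //; move: (size h) (size p); lia.
by exists e.+1, q; rewrite exprSr fE hE mulrAC.
Qed.

(** In characteristic 0 the derivative is nonzero and of smaller degree, so [p] cannot divide it. *)
Lemma irreducible_coprime_deriv p : (forall k, k.+1%:R != 0 :> K) ->
  irreducible_poly p -> coprimep p p^`().
Proof.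
move=> char0 ir; rewrite irreducible_poly_coprime //.
have p0 : p != 0 by apply: irredp_neq0.
have p'0 : p^`() != 0.
  have sz2 : (size p).-2.+1 = (size p).-1 by move: ir.1; move: (size p); lia.
  apply/eqP=> /polyP/(_ (size p).-2); rewrite coef_deriv coef0 sz2 -lead_coefE -sz2.
  by move/eqP; rewrite -mulr_natr mulf_eq0 lead_coef_eq0 (negPf p0) (negPf (char0 _)).
by apply/negP=> /(dvdp_leq p'0); rewrite leqNgt lt_size_deriv.
Qed.

Lemma irreducible_bezout p f : (forall k, k.+1%:R != 0 :> K) ->
  irreducible_poly p -> p \is monic -> f != 0 -> p %| f ->
  exists e q u v, f = p ^+ e.+1 * q /\ u * p + v * (q * p^`()) = 1.
Proof.
move=> char0 ir mp f0 pf.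
have [e [q [fE npq]]] := irreducible_multiplicity ir mp f0 pf.
have /Bezout_eq1_coprimepP[[u v] /= uv] : coprimep p (q * p^`()).
  by rewrite coprimepMr irreducible_coprime_deriv // irreducible_poly_coprime // npq.
by exists e, q, u, v.
Qed.

End PolyFactor.

(** * Points in general position *)

(** Uniqueness of digits in base [N], by which the Kronecker substitution keeps distinct monomials
    distinct. *)
Lemma base_expansion_inj N k (m1 m2 : 'I_k -> nat) :
  (forall i, m1 i < N)%N -> (forall i, m2 i < N)%N ->
  (\sum_i m1 i * N ^ i = \sum_i m2 i * N ^ i)%N -> m1 =1 m2.
Proof.
elim: k m1 m2 => [|k IHk] m1 m2 lt1 lt2; first by move=> _ [].
rewrite !big_ord_recl /= expn0 !muln1.
have shiftE (m : 'I_k.+1 -> nat) : (\sum_(i < k) m (lift ord0 i) * N ^ bump 0 i =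
    N * \sum_(i < k) m (lift ord0 i) * N ^ i)%N.
  by rewrite big_distrr; apply: eq_bigr => i _; rewrite /= expnS mulnCA.
rewrite !shiftE => e.
have e0 : m1 ord0 = m2 ord0.
  have := congr1 (modn^~ N) e; rewrite /= !(mulnC N) ![(_ ord0 + _)%N]addnC.
  by rewrite !modnMDl !modn_small.
have N0 : (0 < N)%N by apply: leq_ltn_trans (lt1 ord0).
have /IHk e1 : (\sum_(i < k) m1 (lift ord0 i) * N ^ i =
    \sum_(i < k) m2 (lift ord0 i) * N ^ i)%N.
  by move: e; rewrite e0 => /addnI/eqP; rewrite eqn_pmul2l // => /eqP.
by move=> i; case: (unliftP ord0 i) => [j|] ->; rewrite ?e0 // e1.
Qed.

Section GenericPoint.
Variables (F : closedFieldType) (n : nat).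

(* Kronecker substitution x_i := t ^ (N ^ i). *)
Lemma mpoly_nonzero_point (p : {mpoly F[n]}) : p != 0 -> exists b, p.@[b] != 0.
Proof.
move=> p0; pose N := msize p.
pose P : {poly F} := mmap polyC (fun i : 'I_n => 'X^(N ^ i)) p.
have PE : P = \sum_(m <- msupp p) p@_m *: 'X^(\sum_i m i * N ^ i).
  rewrite /P /mmap; apply: eq_bigr => m _; rewrite mul_polyC /mmap1; congr (_ *: _).
  by rewrite -prodrXr; apply: eq_bigr => i _; rewrite -exprM mulnC.
have ltN m : m \in msupp p -> forall i, (m i < N)%N.
  move=> mp i; apply: leq_ltn_trans (msize_mdeg_lt mp).
  by rewrite mdegE (bigD1 i) //= leq_addr.
have /closed_nonrootP[t] : P != 0.
  have lp : mlead p \in msupp p by apply: mlead_supp.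
  apply/eqP=> /(congr1 (fun q : {poly F} => q`_(\sum_i mlead p i * N ^ i))).
  rewrite coef0 PE coef_sum (bigD1_seq (mlead p)) ?msupp_uniq //=.
  rewrite coefZ coefXn eqxx mulr1 big1_seq ?addr0 => [/eqP|m /andP[nm mp]].
    by rewrite mleadc_eq0 (negPf p0).
  rewrite coefZ coefXn; case: eqP => [/base_expansion_inj e|]; last by rewrite mulr0.
  case/eqP: nm; apply/mnmP=> i; symmetry; apply: e; exact: ltN.
rewrite rootE => Pt; exists (fun i => t ^+ (N ^ i)); apply: contraNneq Pt => <-; apply/eqP.
apply: (@mpoly_rmorph_eq _ _ _
  (horner_eval t \o mmap polyC (fun i : 'I_n => 'X^(N ^ i))) (meval _)) => [c|i] /=.
  by rewrite /horner_eval mmapC hornerC mevalC.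
by rewrite /horner_eval mmapX mmap1U hornerXn mevalXU.
Qed.

(** Restricted to the line through 0 and a point [beta] where [p] is nonzero, [p] becomes a nonzero
    polynomial in one variable, as its value at 1 shows. *)
Lemma generic_multiples (p : {mpoly F[n]}) k : p != 0 ->
  exists (beta : 'I_n -> F) (t : 'I_k -> F),
    injective t /\ forall j, p.@[fun i => t j * beta i] != 0.
Proof.
move=> /mpoly_nonzero_point[beta pb]; exists beta.
pose P : {poly F} := mmap polyC (fun i : 'I_n => beta i *: 'X) p.
have PE x : P.[x] = p.@[fun i => x * beta i].
  apply: (@mpoly_rmorph_eq _ _ _ (horner_eval x \o
    mmap polyC (fun i : 'I_n => beta i *: 'X)) (meval _)) => [c|i] /=.
    by rewrite /horner_eval mmapC hornerC mevalC.
  by rewrite /horner_eval mmapX mmap1U hornerZ hornerX mevalXU mulrC.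
have P0 : P != 0.
  apply: contraNneq pb => P0; rewrite -[X in X == _](_ : P.[1] = _).
    by rewrite P0 horner0.
  by rewrite PE; apply: meval_eq => i; rewrite mul1r.
have [ts [uniq_ts szts tsP]] : exists ts : seq F,
    [/\ uniq ts, size ts = k & forall x, x \in ts -> P.[x] != 0].
  elim: k => [|k [ts [uts szts tsP]]]; first by exists [::].
  (* The additional factors exclude the parameters already chosen. *)
  have /closed_nonrootP[x] : P * \prod_(z <- ts) ('X - z%:P) != 0.
    by rewrite mulf_neq0 // monic_neq0 // monic_prod_XsubC.
  rewrite rootM negb_or root_prod_XsubC rootE => /andP[Px xts].
  exists (x :: ts); rewrite /= xts uts szts; split=> // z.
  by rewrite inE => /orP[/eqP->|/tsP].
exists (fun j => ts`_j); split=> [i j /eqP|j].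
  by rewrite nth_uniq ?szts // => /eqP/val_inj.
by rewrite -PE; apply: tsP; apply: mem_nth; rewrite szts.
Qed.

End GenericPoint.

(** * Fractions *)

Section Fractions.
Variables (R : idomainType) (K : fieldType) (iota : {rmorphism R -> K}).
Hypothesis iota_inj : injective iota.
Hypothesis fracP : forall z, exists a b, b != 0 /\ z = iota a / iota b.

Lemma common_denominator (zs : seq K) : exists2 D, D != 0 &
  forall z, z \in zs -> exists a, z = iota a / iota D.
Proof.
have nz b : b != 0 -> iota b != 0 by rewrite -(rmorph0 iota) (inj_eq iota_inj).
elim: zs => [|z zs [D D0 DP]]; first by exists 1; rewrite ?oner_neq0.
have [a [b [b0 ->]]] := fracP z.
exists (b * D) => [|y]; first by rewrite mulf_neq0.
rewrite inE => /orP[/eqP->|/DP[c ->]].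
  by exists (a * D); rewrite !rmorphM -mulf_div divff ?mulr1 // nz.
by exists (b * c); rewrite !rmorphM -mulf_div divff ?mul1r // nz.
Qed.

Lemma common_denominator_poly (ps : seq {poly K}) : exists2 D, D != 0 &
  forall p, p \in ps -> forall i, exists a, p`_i = iota a / iota D.
Proof.
have [D D0 DP] := common_denominator (flatten [seq polyseq p | p <- ps]).
exists D => // p pps i; have [lti|gei] := ltnP i (size p).
  by apply: DP; apply/flatten_mapP; exists p => //; apply: mem_nth.
by exists 0; rewrite nth_default // rmorph0 mul0r.
Qed.

Variable phi : {rmorphism R -> R}.
Hypothesis phi_neq0 : forall a, a != 0 -> phi a != 0.

(** Denominators stay nonzero under [phi], so it extends to fractions. With [phi := shift b],
    regularity at [b] turns into regularity at the origin. *)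
Lemma fraction_morphism : exists sigma : {rmorphism K -> K},
  forall a, sigma (iota a) = iota (phi a).
Proof.
have nz b : b != 0 -> iota b != 0 by rewrite -(rmorph0 iota) (inj_eq iota_inj).
have nz' b : b != 0 -> iota (phi b) != 0 by move=> /phi_neq0/nz.
have ex z : exists ab : R * R, (ab.2 != 0) && (z == iota ab.1 / iota ab.2).
  by have [a [b [b0 ->]]] := fracP z; exists (a, b); rewrite b0 eqxx.
(* A representative of each fraction is chosen; [sE] shows that the choice does not matter. *)
pose s z := iota (phi (xchoose (ex z)).1) / iota (phi (xchoose (ex z)).2).
have sE a b : b != 0 -> s (iota a / iota b) = iota (phi a) / iota (phi b).
  move=> b0; rewrite /s; set ab := xchoose _.
  have /andP[c0 /eqP/eqP] := xchooseP (ex (iota a / iota b)); rewrite -/ab in c0 *.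
  rewrite eqr_div ?nz // -!rmorphM (inj_eq iota_inj) => /eqP e.
  apply/eqP; rewrite eqr_div ?nz' // -!rmorphM -e; apply/eqP.
  by congr (iota (phi _)); rewrite mulrC.
have sadd : zmod_morphism s.
  move=> x y; have [a [b [b0 ->]]] := fracP x; have [c [d [d0 ->]]] := fracP y.
  rewrite -mulNr addf_div ?nz // -!rmorphN -!rmorphM -!rmorphD sE ?mulf_neq0 //.
  by rewrite !sE // -mulNr addf_div ?nz' // -!rmorphN -!rmorphM -!rmorphD.
have smul : monoid_morphism s.
  split=> [|x y].
    rewrite -[1 in LHS](@divff _ (iota 1)) ?nz ?oner_neq0 // sE ?oner_neq0 //.
    by rewrite divff // nz' ?oner_neq0.
  have [a [b [b0 ->]]] := fracP x; have [c [d [d0 ->]]] := fracP y.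
  by rewrite mulf_div -!rmorphM !sE ?mulf_neq0 // mulf_div -!rmorphM.
pose s1 := GRing.isZmodMorphism.Build K K s sadd.
pose s2 := GRing.isMonoidMorphism.Build K K s smul.
pose sigma : {rmorphism K -> K} := HB.pack s s1 s2.
exists sigma => a; rewrite -[iota a]divr1 -(rmorph1 iota).
by rewrite -[LHS]/(s (iota a / iota 1)) sE ?oner_neq0 // !rmorph1 !divr1.
Qed.

End Fractions.

(** * Elimination of divisions *)

Section Division.
Variables (F : fieldType) (n : nat).
Local Notation R := {mpoly F[n]}.
Variables (K : fieldType) (iota : {rmorphism R -> K}).
Hypothesis iota_inj : injective iota.
Local Notation pslp := (slp false (@mpoly_leaf F n)).

(** Arithmetic on pairs needs at most four polynomial entries per operation; inverting swaps the
    pair. *)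
Lemma slp_num_den (L : seq K) : slp true (frac_leaf iota) L ->
  exists l, [/\ pslp l, (size l <= 4 * size L)%N &
    forall z, z \in L -> exists P Q,
      [/\ P \in l, Q \in l, Q != 0 & z = iota P / iota Q]].
Proof.
have nz Q : Q != 0 -> iota Q != 0 by rewrite iota_eq0.
have leafC c : mpoly_leaf (c%:MP : R) by right; exists c.
elim=> {L} [|_ L [p lp ->] _|x y L xL yL _|x y L xL yL _|x L _ xL _].
- by exists [::]; split=> //; apply: slp_nil.
- move=> [l [sl zl memL]]; exists [:: p, 1%:MP & l]; split=> [||z].
  + by apply: slp_leaf => //; apply: slp_leaf.
  + by move: zl => /=; move: (size l) (size L); lia.
  + rewrite inE => /orP[/eqP->|/memL[P [Q [Pl Ql Q0 zE]]]].
      exists p, 1%:MP; rewrite !inE !eqxx orbT mpolyC1 oner_neq0; split=> //.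
      by rewrite rmorph1 divr1.
    by exists P, Q; rewrite !inE Pl Ql !orbT.
- move=> [l [sl zl memL]].
  have [P1 [Q1 [P1l Q1l Q10 xE]]] := memL _ xL.
  have [P2 [Q2 [P2l Q2l Q20 yE]]] := memL _ yL.
  exists [:: Q1 * Q2, P1 * Q2 + P2 * Q1, P1 * Q2, P2 * Q1 & l]; split=> [||z].
  + apply: slp_mul; rewrite ?inE ?Q1l ?Q2l ?orbT //.
    apply: slp_add; rewrite ?inE ?eqxx ?orbT //.
    by do 2![apply: slp_mul; rewrite ?inE ?P1l ?P2l ?Q1l ?Q2l ?orbT //].
  + by move: zl => /=; move: (size l) (size L); lia.
  + rewrite inE => /orP[/eqP->|/memL[P [Q [Pl Ql Q0 zE]]]].
      exists (P1 * Q2 + P2 * Q1), (Q1 * Q2); rewrite !inE !eqxx !orbT mulf_neq0 //.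
      by split=> //; rewrite xE yE addf_div ?nz // -!rmorphM -rmorphD.
    by exists P, Q; rewrite !inE Pl Ql !orbT.
- move=> [l [sl zl memL]].
  have [P1 [Q1 [P1l Q1l Q10 xE]]] := memL _ xL.
  have [P2 [Q2 [P2l Q2l Q20 yE]]] := memL _ yL.
  exists [:: Q1 * Q2, P1 * P2 & l]; split=> [||z].
  + by do 2![apply: slp_mul; rewrite ?inE ?P1l ?P2l ?Q1l ?Q2l ?orbT //].
  + by move: zl => /=; move: (size l) (size L); lia.
  + rewrite inE => /orP[/eqP->|/memL[P [Q [Pl Ql Q0 zE]]]].
      exists (P1 * P2), (Q1 * Q2); rewrite !inE !eqxx !orbT mulf_neq0 //.
      by split=> //; rewrite xE yE mulf_div -!rmorphM.
    by exists P, Q; rewrite !inE Pl Ql !orbT.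
- move=> [l [sl zl memL]].
  have [P1 [Q1 [P1l Q1l Q10 xE]]] := memL _ xL.
  exists [:: 0%:MP, 1%:MP & l]; split=> [||z].
  + by apply: slp_leaf => //; apply: slp_leaf.
  + by move: zl => /=; move: (size l) (size L); lia.
  + rewrite inE => /orP[/eqP->|/memL[P [Q [Pl Ql Q0 zE]]]]; last first.
      by exists P, Q; rewrite !inE Pl Ql !orbT.
    (* Inversion sends 0 to 0, so a zero numerator calls for the pair [0], [1] instead of a swap. *)
    have [P10|P1n0] := eqVneq P1 0.
      exists 0%:MP, 1%:MP; rewrite !inE !eqxx !orbT mpolyC1 mpolyC0 oner_neq0.
      by split=> //; rewrite xE P10 !rmorph0 !mul0r invr0.
    by exists Q1, P1; rewrite !inE P1l Q1l !orbT xE invf_div.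
Qed.

End Division.

(** * Power series quotients *)

Section Quotient.
Variables (F : fieldType) (n : nat).
Local Notation R := {mpoly F[n]}.

(** The constant term of [b] makes it a unit among power series, and [h] is the expansion of
    [a / b]; cancelling [b] in [A b = B a] gives [A = B h]. The inverse of [b] is handled through
    the truncations [inv N], exact up to order [N]. *)
Lemma mseries_quotient_exists (A B a b g : R) d :
  B != 0 -> b@_0 != 0 -> A * b = B * a -> order_ge d.+1 (a - g * b) ->
  exists h, mseries_quotient A B h /\ mseries_eqmod d (mseries_of_mpoly g) h.
Proof.
move=> B0 b0 Ab og.
(* Thus [b] is its constant term times [1 - x], with [x] of order at least 1, and [inv N] is a
   truncated geometric series. *)
pose x := 1 - (b@_0)^-1%:MP * b.
pose inv N := (b@_0)^-1%:MP * \sum_(i < N) x ^+ i.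
have ox N : order_ge N (x ^+ N).
  rewrite -[N in order_ge N]muln1; apply: order_geX; apply: order_ge1.
  by rewrite mcoeffB mcoeff1 eqxx mcoeffCM mulVf // subrr.
have invP N : b * inv N = 1 - x ^+ N.
  have := subrX1 x N; rewrite {2}/x => e; rewrite /inv.
  have -> : 1 - x ^+ N = - (x ^+ N - 1) by ring.
  by rewrite e; ring.
have cancel N c : order_ge N (b * c) -> order_ge N c.
  move=> obc; have -> : c = inv N * (b * c) + c * x ^+ N.
    by rewrite mulrA [inv N * b]mulrC invP; ring.
  by apply: order_geD; apply: order_geMl.
(* The truncation depends on [m]; by [hE], any longer one yields the same coefficient. *)
pose h m := (a * inv (mdeg m).+1)@_m.
have hE N m : (mdeg m < N)%N -> h m = (a * inv N)@_m.
  move=> lt; apply/eqP; rewrite eq_sym -subr_eq0 -mcoeffB -mulrBr; apply/eqP.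
  apply: (_ : order_ge (mdeg m).+1 _) => //; apply: order_geMl; apply: cancel.
  rewrite mulrBr !invP.
  have -> : 1 - x ^+ N - (1 - x ^+ (mdeg m).+1) = x ^+ (mdeg m).+1 - x ^+ N by ring.
  by apply: order_geD => //; apply: order_geN; apply: order_ge_le (ox N).
exists h; split; first split=> // m.
  pose N := (mdeg m).+1.
  have -> : mseries_mul (mseries_of_mpoly B) h m =
      mseries_mul (mseries_of_mpoly B) (mseries_of_mpoly (a * inv N)) m.
    apply: eq_bigr => k _; congr (_ * _); apply: hE; exact: bmdeg.
  rewrite -mseries_of_mpolyM; apply/eqP; rewrite -subr_eq0 -mcoeffB; apply/eqP.
  apply: (_ : order_ge N _) => //; apply: cancel.
  have -> : b * (A - B * (a * inv N)) = B * a * x ^+ N.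
    have -> : b * (A - B * (a * inv N)) = A * b - B * a * (b * inv N) by ring.
    by rewrite Ab invP; ring.
  exact: order_geMl.
move=> m led; apply/eqP; rewrite -subr_eq0 -mcoeffB; apply/eqP.
apply: (_ : order_ge (mdeg m).+1 _) => //; apply: cancel.
have -> : b * (g - a * inv (mdeg m).+1) = a * x ^+ (mdeg m).+1 - (a - g * b).
  have -> : b * (g - a * inv (mdeg m).+1) = g * b - a * (b * inv (mdeg m).+1) by ring.
  by rewrite invP; ring.
apply: order_geD; first exact: order_geMl.
by apply: order_geN; apply: order_ge_le og.
Qed.

End Quotient.

(** * Approximation of a factor *)

Section Approximation.
Variables (F : closedFieldType) (n : nat).
Local Notation R := {mpoly F[n]}.
Variables (K : fieldType) (iota : {rmorphism R -> K}).
Hypothesis iota_inj : injective iota.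
Hypothesis fracP : forall z, exists a b, b != 0 /\ z = iota a / iota b.
Hypothesis char0 : forall k, k.+1%:R != 0 :> F.
Local Notation fconst := (fconst iota).
Local Notation adic := (adic iota).
Local Notation fcomputable := (computable true (frac_leaf iota)).
#[local] Hint Resolve iota_inj : core.

Variables (f g : R) (s d : nat).
Hypothesis f_slp : computable false (@mpoly_leaf F n) s f.
Hypothesis f_neq0 : f != 0.
Hypothesis g_dvd : exists q, f = g * q.
Hypothesis g_size : msize g = d.+1.

(** One denominator [D] serves all coefficients, so a single inequation [D(b) != 0] makes both
    identities regular at [b]. *)
Definition newton_data (alpha : 'I_n -> F) (D : R) (p : {poly K}) : Prop :=
  exists e q u v,
  [/\ p \is monic /\ (1 < size p)%N,
      line iota (fun=> 0) alpha f = p ^+ e.+1 * q,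
      u * p + v * (q * p^`()) = 1
    & forall r, r \in [:: p; q; u; v] -> forall i, exists a, r`_i = iota a / iota D].

Lemma line_factors : exists (alpha : 'I_n -> F) (c : F) (D : R) (ps : seq {poly K}),
  [/\ D != 0, line iota (fun=> 0) alpha g = fconst c *: \prod_(p <- ps) p,
      (\sum_(p <- ps) (size p).-1 = d)%N
    & forall p, p \in ps -> newton_data alpha D p].
Proof.
(* Off the zeros of the top form, [g] on the line has degree exactly [d] and a leading coefficient
   in [F]. *)
have [alpha top0] := mpoly_nonzero_point (topform_neq0 g_size).
exists alpha, (topform d g).@[alpha].
pose lin := line iota (fun=> 0) alpha.
have lin_neq0 r : r != 0 -> lin r != 0.
  apply: contraNneq => l0; have := horner0_line iota (fun=> 0) alpha r.
  by rewrite -/lin l0 horner0 shift0 => /esym/eqP; rewrite iota_eq0.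
have g0 : g != 0 by rewrite -msize_poly_eq0 g_size.
have topg : (lin g)`_d = fconst (topform d g).@[alpha].
  by apply: line_topcoef; rewrite g_size.
have szg : size (lin g) = d.+1.
  apply/eqP; rewrite eqn_leq -[X in (_ <= X)%N && _]g_size size_line ltnNge.
  apply/negP=> /leq_sizeP/(_ _ (leqnn d))/eqP.
  by rewrite topg fmorph_eq0 (negPf top0).
have lcg : lead_coef (lin g) = fconst (topform d g).@[alpha].
  by rewrite lead_coefE szg topg.
have [ps psP linE] := irreducible_factorization (lin_neq0 _ g0).
have char0K k : k.+1%:R != 0 :> K.
  by rewrite -(rmorph_nat fconst) fmorph_eq0.
have ps_dvd p : p \in ps -> p %| lin f.
  move=> pps; have [q ->] := g_dvd; rewrite /lin rmorphM /= dvdp_mulr // -/(lin g) linE.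
  rewrite dvdpZr ?lead_coef_eq0 ?lin_neq0 //.
  by rewrite (big_rem p) //= dvdp_mulr.
have [D D0 DP] : exists2 D, D != 0 & forall p, p \in ps -> newton_data alpha D p.
  elim: ps psP ps_dvd {linE} => [|p ps IHps] psP ps_dvd.
    by exists 1; rewrite ?oner_neq0.
  have [r rps|r rps|D D0 DP] := IHps.
  - by apply: psP; rewrite inE rps orbT.
  - by apply: ps_dvd; rewrite inE rps orbT.
  have [|ir mp] := psP p; first by rewrite inE eqxx.
  have [|e [q [u [v [fE uv]]]]] :=
    irreducible_bezout char0K ir mp (lin_neq0 _ f_neq0).
    by apply: ps_dvd; rewrite inE eqxx.
  have [D' D'0 D'P] := common_denominator_poly iota_inj fracP [:: p; q; u; v].
  exists (D * D') => [|r]; first by rewrite mulf_neq0.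
  rewrite inE => /orP[/eqP->|/DP[e' [q' [u' [v' [mr fE' uv' denr]]]]]].
    exists e, q, u, v; split=> // [|t tin i]; first by split=> //; apply: ir.1.
    have [a ->] := D'P t tin i; exists (D * a).
    by rewrite !rmorphM -mulf_div divff ?mul1r // iota_eq0.
  exists e', q', u', v'; split=> // t tin i.
  have [a ->] := denr t tin i; exists (a * D').
  by rewrite !rmorphM -mulf_div divff ?mulr1 // iota_eq0.
exists D, ps; split=> //; first by rewrite -/lin linE lcg.
have : size (\prod_(p <- ps) p) = d.+1.
  by rewrite -szg linE size_scale // lead_coef_eq0 lin_neq0.
rewrite size_prod_seq => [|p /psP[ir _]]; last exact: irredp_neq0.
have sz1 p : p \in ps -> size p = ((size p).-1).+1.
  by move/psP=> [ir _]; rewrite prednK // ltnW // ir.1.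
rewrite (eq_big_seq (fun p : {poly K} => (1 + (size p).-1)%N)) => [|p /sz1 //].
rewrite big_split /= sum1_size.
by move: (size ps) (\sum_(p <- ps) _)%N; lia.
Qed.

Let cost := (d * (6 * s + 5) + 4)%N.

(** The extension [sigma] of [shift b] carries the line through [x] to the line through [x + b] and
    [D] to a polynomial with constant term [D(b)]. The transported coefficients are therefore
    regular, and [factor_approx] applies to each factor, repeated ones included. *)
Lemma shifted_factor_approx alpha c D (ps : seq {poly K}) (b : 'I_n -> F) :
  line iota (fun=> 0) alpha g = fconst c *: \prod_(p <- ps) p ->
  (\sum_(p <- ps) (size p).-1 = d)%N ->
  (forall p, p \in ps -> newton_data alpha D p) -> D.@[b] != 0 ->
  exists r, adic d.+1 (r - iota (shift b g)) /\ fcomputable (d * (cost + 2)).+3 r.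
Proof.
move=> gE szps psP Db.
have [sigma sigmaE] := fraction_morphism iota_inj fracP (@shift_neq0 F n b).
have sigmaC a : sigma (fconst a) = fconst a by rewrite sigmaE /= shiftC.
have lineE p : line iota b alpha p = map_poly sigma (line iota (fun=> 0) alpha p).
  apply: (@mpoly_rmorph_eq _ _ _ (line iota b alpha)
    (map_poly sigma \o line iota (fun=> 0) alpha)) => [a|i] /=.
    by rewrite !lineC map_polyC /= sigmaC.
  rewrite !lineX (rmorphD (map_poly sigma)) /= map_polyC map_polyZ map_polyX /=.
  by rewrite sigmaC mpolyC0 addr0 sigmaE /= shiftX.
have adic_sigma (r : {poly K}) : (forall i, exists a, r`_i = iota a / iota D) ->
    forall i, adic 0 (map_poly sigma r)`_i.
  move=> den i; have [a rE] := den i; exists (shift b a), (shift b D).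
  by split=> //; rewrite ?coef_map /= ?rE ?fmorph_div ?sigmaE // mcoeff0_shift.
have [w [aw cw]] : exists w,
    adic d.+1 ((\prod_(p <- ps) map_poly sigma p).[0] - w) /\
    fcomputable ((\sum_(p <- ps) (size p).-1) * (cost + 2)).+1 w.
  elim: ps psP {gE szps} => [|p ps IHps] psP.
    exists 1; rewrite !big_nil hornerC subrr; split; first exact: adic0.
    by apply: computable_leaf; rewrite -(rmorph1 fconst); apply: frac_leafC.
  have [r rps|w [aw cw]] := IHps; first by apply: psP; rewrite inE rps orbT.
  have [|e [q [u [v [[mp szp] fE uv den]]]]] := psP p; first by rewrite inE eqxx.
  have adic_s r : r \in [:: p; q; u; v] -> forall i, adic 0 (map_poly sigma r)`_i.
    by move=> rin; apply: adic_sigma; apply: den.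
  have ap := adic_s p _; have aq := adic_s q _; have au := adic_s u _.
  have av := adic_s v _; rewrite !inE !eqxx !orbT in ap aq au av.
  have fE' : line iota b alpha f = map_poly sigma p ^+ e.+1 * map_poly sigma q.
    by rewrite lineE fE rmorphM rmorphXn.
  have uv' : map_poly sigma u * map_poly sigma p + map_poly sigma v *
      (map_poly sigma q * (map_poly sigma p)^`()) = 1.
    by rewrite deriv_map -!rmorphM -rmorphD uv rmorph1.
  have mp' : map_poly sigma p \is monic by rewrite map_monic.
  have [z [az cz]] := factor_approx iota_inj char0 f_slp (ap isT) (aq isT)
    (au isT) (av isT) fE' uv' mp' d.
  exists (z * w); split.
    rewrite big_cons hornerM; set X := _.[0]; set Y := _.[0].
    (* Here [Y - (Y - w)] stands for [w], which is regular because [Y] and its error are. *)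
    have -> : X * Y - z * w = X * (Y - w) + (X - z) * (Y - (Y - w)) by ring.
    have ahorner (r : {poly K}) : (forall i, adic 0 r`_i) -> adic 0 r.[0].
      by move=> ar; apply: adic_mod_horner => //; apply: adic0.
    have aY : adic 0 Y.
      rewrite /Y horner_prod big_seq; apply: adic_prod => // r rps.
      apply: ahorner; apply: adic_sigma.
      have [|e' [q' [u' [v' [_ _ _ den']]]]] := psP r; first by rewrite inE rps orbT.
      by apply: den'; rewrite inE eqxx.
    apply: adicD => //; first by apply: adicMl => //; apply: ahorner; apply: ap.
    by apply: adicMr => //; apply: adicB => //; apply: adic_le aw.
  apply: computable_le (computable_mul cz cw).
  rewrite size_map_poly big_cons mulnDl !mulnDr /cost.
  by move: (\sum_(p <- ps) _)%N szp; case: (size p) => [|[|k]] // S _; nia.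
exists (fconst c * w); split.
  have -> : iota (shift b g) = fconst c * (\prod_(p <- ps) map_poly sigma p).[0].
    rewrite -(horner0_line iota b alpha) lineE gE map_polyZ /= sigmaC hornerZ.
    by rewrite rmorph_prod.
  rewrite -mulrBr -opprB mulrN; apply: adicN; apply: adicMl => //; exact: adic_const.
have := computable_mul (computable_leaf true (frac_leafC iota c)) cw.
by rewrite szps add1n.
Qed.

Lemma factor_approximation : exists z,
  adic d.+1 (z - iota g) /\ fcomputable (d.+1 * (d * (cost + 2) + 6)).+1 z.
Proof.
have [alpha [c [D [ps [D0 gE szps psP]]]]] := line_factors.
have [beta [t [inj_t tP]]] := generic_multiples d.+1 D0.
have [r rP] : exists r : 'I_d.+1 -> K, forall j,
    adic d.+1 (r j - iota (shift (fun i => t j * beta i) g)) /\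
    fcomputable (d * (cost + 2)).+3 (r j).
  apply: (@fin_all_exists 'I_d.+1 (fun=> K) (fun j x =>
    adic d.+1 (x - iota (shift (fun i => t j * beta i) g)) /\
    fcomputable (d * (cost + 2)).+3 x)) => j.
  exact: shifted_factor_approx gE szps psP (tP j).
(* The Lagrange weights at 0 lie in [F]: each is one leaf and preserves the order in [x]. *)
pose w i := \prod_(j | j != i) ((0 - t j) / (t i - t j)).
exists (\sum_j fconst (w j) * r j); split.
  have -> : iota g = \sum_j fconst (w j) * iota (shift (fun i => t j * beta i) g).
    have inj_ct : injective (fun j => fconst (t j)).
      by move=> i j /fmorph_inj/inj_t.
    have := horner0_line iota (fun=> 0) beta g; rewrite shift0 => <-.
    rewrite (lagrange_horner _ inj_ct); last by rewrite -g_size size_line.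
    apply: eq_bigr => i _; rewrite horner_line_shift mulrC rmorph_prod.
    congr (_ * _); apply: eq_bigr => j _.
    by rewrite fmorph_div !rmorphB rmorph0.
  rewrite -sumrB; apply: adic_sum => // j _; rewrite -mulrBr.
  by apply: adicMl => //; [apply: adic_const | case: (rP j)].
have -> : (d.+1 * (d * (cost + 2) + 6))%N =
    (\sum_(j : 'I_d.+1) (1 + (d * (cost + 2)).+3).+2)%N.
  by rewrite sum_nat_const card_ord; congr (_ * _)%N; lia.
apply: computable_sum => [|j _].
  by rewrite -(rmorph0 fconst); apply: frac_leafC.
apply: computable_mul; last by case: (rP j).
exact: computable_leaf (frac_leafC _ _).
Qed.

Lemma factor_quotient : exists (A B : R) (CA CB : circuit F n),
    [/\ computes CA A,
        computes CB B,
        (circuit_size CA <= 12 * (d.+1 * (d * (cost + 2) + 6)).+1)%N,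
        (circuit_size CB <= 12 * (d.+1 * (d * (cost + 2) + 6)).+1)%N
      & exists h : mseries F n,
          mseries_quotient A B h /\
          mseries_eqmod d (mseries_of_mpoly g) h].
Proof.
have [z [[a [b [zE b0 oa]]] [L [sL zL zinL]]]] := factor_approximation.
have [l [sl zl memL]] := slp_num_den iota_inj sL.
have [A [B [Al Bl B0 zE']]] := memL _ zinL.
have [|CA cA sA] := @circuit_of_slp _ _ (size l) A; first by exists l.
have [|CB cB sB] := @circuit_of_slp _ _ (size l) B; first by exists l.
(* The factor 12 is 4 from [slp_num_den] times 3 from [circuit_of_slp]. *)
have bound : (3 * size l <= 12 * (d.+1 * (d * (cost + 2) + 6)).+1)%N.
  by move: zL zl; move: (size L) (size l) (_ * _)%N; lia.
exists A, B, CA, CB; split=> //; try exact: leq_trans bound.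
(* As [z - g] is [a / b] with [a] of order at least [d + 1], the regular form of [z] is
   [(a + g b) / b]. *)
apply: (@mseries_quotient_exists _ _ A B (a + g * b) b) => //; last by rewrite addrK.
have bF : iota b != 0 by rewrite iota_eq0 // mcoeff0_neq0.
have {}zE : z = iota (a + g * b) / iota b.
  by rewrite rmorphD (rmorphM iota) mulrDl mulfK // -zE subrK.
move/eqP: zE'; rewrite zE eqr_div // ?iota_eq0 // -!rmorphM (inj_eq iota_inj) => /eqP.
by move=> e; rewrite -e mulrC.
Qed.

End Approximation.

(** * The field of fractions and the final size bound *)

Lemma fraction_numden (R : idomainType) (z : {fraction R}) :
  exists a b, b != 0 /\ z = FracField.tofrac a / FracField.tofrac b.
Proof.
elim/quotW: z => x; exists (frac x).1, (frac x).2.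
have x0 : (frac x).2 != 0 by apply: denom_ratioP.
split=> //; apply: (canRL (mulfK _)); first by rewrite tofrac_eq0.
rewrite -[LHS]/(FracField.mul _ _) !piE; apply/eqmodP.
rewrite /= FracField.equivfE /FracField.mulf !numden_Ratio ?oner_neq0 ?mulr1 //.
by rewrite mulrC.
Qed.

(** For [N >= 2] the factor [k] is absorbed by [N^k]; the additive [c] covers [N = 0] and
    [N = 1]. *)
Lemma cubic_le_power (k : nat) :
  exists c, (k <= c)%N /\ forall N, (k * N ^ 3 <= N ^ c + c)%N.
Proof.
exists (k + 3)%N; split=> [|[|[|N]]]; rewrite ?leq_addr ?muln0 //.
  by rewrite !exp1n; lia.
rewrite expnD; apply: leq_trans (leq_addr _ _); rewrite leq_mul2r.
by apply/orP; right; apply/ltnW/ltn_expl.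
Qed.

(** Here [564 = 12 * 47], [47 = 2 * 23 + 1], [23 = 17 + 6] and [17 = 6 + 5 + 6]: each lower-order
    term is bounded by a multiple of a power of [N >= 1]. *)
Lemma cost_bound s d : (0 < s)%N -> (0 < d)%N ->
  (12 * (d.+1 * (d * (d * (6 * s + 5) + 4 + 2) + 6)).+1 <= 564 * (s * d) ^ 3)%N.
Proof.
move=> s0 d0; set N := (s * d)%N.
have N0 : (0 < N)%N by rewrite muln_gt0 s0.
have dN : (d <= N)%N by rewrite leq_pmull.
have c1 : (d * (6 * s + 5) + 4 + 2 <= 17 * N)%N by rewrite /N in N0 dN *; nia.
have c2 : (d * (d * (6 * s + 5) + 4 + 2) + 6 <= 23 * (N * N))%N.
  by have := leq_mul dN c1; nia.
have c3 : (d.+1 <= 2 * N)%N by lia.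
have := leq_mul c3 c2; rewrite (_ : (N ^ 3 = N * N * N)%N).
  by move: (d.+1 * _)%N; nia.
by rewrite !expnS muln1 mulnA.
Qed.

Theorem theorem1p2 :
  exists c : nat,
  forall (F : closedFieldType) (n : nat) (f g : {mpoly F[n]})
    (Cf : circuit F n) (s d : nat),
    [pchar F] =i pred0 ->
    computes Cf f -> circuit_size Cf = s ->
    f != 0 ->
    (exists q : {mpoly F[n]}, f = g * q) ->
    msize g = d.+1 ->
  exists (A B : {mpoly F[n]}) (CA CB : circuit F n),
    [/\ computes CA A,
        computes CB B,
        (circuit_size CA <= (s * d) ^ c + c)%N,
        (circuit_size CB <= (s * d) ^ c + c)%N
      & exists h : mseries F n,
          mseries_quotient A B h /\
          mseries_eqmod d (mseries_of_mpoly g) h].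
Proof.
have [c [lec cP]] := cubic_le_power 564; exists c => F n f g Cf s d char0 Cf_f szC.
move=> f0 g_dvd szg.
have s0 : (0 < s)%N.
  by rewrite -szC addn_gt0; apply/orP; left; apply/card_gt0P; exists (output Cf).
have nat_neq0 k : k.+1%:R != 0 :> F by rewrite ((pcharf0P F).1 char0).
have f_slp := slp_of_circuit Cf_f; rewrite szC in f_slp.
have iota_inj : injective (@FracField.tofrac {mpoly F[n]}).
  by move=> p q /eqP; rewrite tofrac_eq => /eqP.
have [A [B [CA [CB [cA cB sA sB hP]]]]] := factor_quotient iota_inj
  (@fraction_numden {mpoly F[n]}) nat_neq0 f_slp f0 g_dvd szg.
have bound : (12 * (d.+1 * (d * (d * (6 * s + 5) + 4 + 2) + 6)).+1
    <= (s * d) ^ c + c)%N.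
  (* For [d = 0] the product [s * d] vanishes; the left side is then 84, which the additive [c]
     covers. *)
  have [->|d0] := posnP d; last exact: leq_trans (cost_bound s0 d0) (cP _).
  by apply: leq_trans (leq_addl _ _); apply: leq_trans lec.
by exists A, B, CA, CB; split=> //; apply: leq_trans bound.
Qed.
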